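(* Let $K \subset \mathbb R^3$ be a regular convex non-ellipsoidal cone with everywhere positively curved boundary of class $C^k$, $k \geq 5$. Let $\gamma$ be the projective image of $\partial K$ in $\mathbb{RP}^2$. Then any two balanced $2\pi$-periodic parametrizations of $\gamma$, by variables $t$ and $s$ respectively, differ by an additive constant, i.e. $s - t$ is constant.
   Context: A regular convex cone is a closed convex cone with non-empty interior containing no lines. ''Positively curved boundary'' means $\partial K\setminus\{0\}$ has everywhere positive curvature (transverse to the rays), so that $\gamma$ is a simple closed strictly convex curve without inflection points. An ellipsoidal cone is the image of the Lorentz cone $\{(x_0,x_1,x_2): x_0 \geq \sqrt{x_1^2+x_2^2}\}$ under an invertible linear map. A $2\pi$-periodic parametrization of $\gamma$ by a real variable $t$ (one period corresponding to one traversal of $\gamma$, orientation-preserving reparametrizations being considered) is called balanced if there exists a $2\pi$-periodic lift $y(t)$ of $\gamma$ to $\partial K\subset\mathbb R^3$ with $\det(y'',y',y)\equiv 1$ which solves $y''' + 2\alpha y' + \alpha' y + \beta y = 0$ for some function $\beta$ and with $\alpha$ a constant. *)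

(* Defs.v *)
From HB Require Import structures.
From mathcomp Require Import all_boot all_order all_algebra.
From mathcomp Require Import all_classical all_reals all_analysis.
Set Implicit Arguments. Unset Strict Implicit. Unset Printing Implicit Defensive.
Import Order.TTheory GRing.Theory Num.Theory.
Import numFieldNormedType.Exports.
Local Open Scope classical_set_scope.
Local Open Scope ring_scope.

Section Defs.
Variable R : realType.
Notation V := 'rV[R]_3.

Definition det3 (a b c : V) : R :=
  \det (\matrix_(i < 3, j < 3)
          (if i == 0 :> nat then a 0 j else if i == 1 :> nat then b 0 j else c 0 j)).

Definition regular_convex_cone (K : set V) : Prop :=
  [/\ closed K,
      (forall x y, K x -> K y -> K (x + y)),
      (forall (a : R) x, 0 <= a -> K x -> K (a *: x)),
      interior K !=set0
    & (forall x, K x -> K (- x) -> x = 0)].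

Definition bd (K : set V) : set V := K `\` interior K.

Definition lorentz_cone : set V :=
  [set x | Num.sqrt (x 0 1 ^+ 2 + x 0 2 ^+ 2) <= x 0 0].

Definition ellipsoidal (K : set V) : Prop :=
  exists A : 'M[R]_3, A \in unitmx /\ K = [set x *m A | x in lorentz_cone].

(* x and y represent the same point of RP^2 via positive rescaling of rays *)
Definition same_ray (x y : V) : Prop := exists lam : R, 0 < lam /\ y = lam *: x.

(* p : R -> V represents a 2pi-periodic parametrization of gamma (the
   projective image of bd K): each p t is a nonzero boundary point (a
   representative of its ray), p is 2pi-periodic up to the ray, and one
   period traverses gamma exactly once. *)
Definition gamma_param (K : set V) (p : R -> V) : Prop :=
  [/\ (forall t, bd K (p t) /\ p t != 0),
      (forall t, same_ray (p t) (p (t + 2 * pi)))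
    & (forall x, bd K x -> x != 0 ->
        exists t, [/\ 0 <= t < 2 * pi, same_ray (p t) x &
          forall t', 0 <= t' < 2 * pi -> same_ray (p t') x -> t' = t])].

Definition Ck (k : nat) (f : R -> V) : Prop :=
  (forall n, (n < k)%N -> forall t, derivable (derive1n n f) t 1)
  /\ continuous (derive1n k f).

(* bd K \ {0} is of class C^k with everywhere positive curvature transverse
   to the rays: it is swept out by the rays of a C^k, 2pi-periodic curve c
   (traversing gamma once) with det(c'', c', c) <> 0 (the second fundamental
   form of (r,t) |-> r c(t) is diag(0, r det(c,c',c''))). *)
Definition Ck_pos_curved_boundary (K : set V) (k : nat) : Prop :=
  exists c : R -> V,
    [/\ gamma_param K c, Ck k c, (forall t, c (t + 2 * pi) = c t)
      & (forall t, det3 (derive1n 2 c t) (derive1n 1 c t) (c t) != 0)].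

Definition balanced (K : set V) (p : R -> V) : Prop :=
  gamma_param K p /\
  exists (y : R -> V) (alpha : R) (beta : R -> R),
    [/\ (forall t, y (t + 2 * pi) = y t),
        (forall t, bd K (y t) /\ same_ray (p t) (y t)),
        (forall n, (n < 3)%N -> forall t, derivable (derive1n n y) t 1),
        (forall t, det3 (derive1n 2 y t) (derive1n 1 y t) (y t) = 1)
      & (forall t, derive1n 3 y t + (2 * alpha) *: derive1n 1 y t
                   + (derive1 (fun _ : R => alpha) t) *: y t
                   + beta t *: y t = 0)].

End Defs.

(* Main.v *)
Require Import Defs.
From HB Require Import structures.
From mathcomp Require Import all_boot all_order all_algebra.
From mathcomp Require Import all_classical all_reals all_analysis.
From mathcomp Require Import ring lra zify.
Set Implicit Arguments. Unset Strict Implicit. Unset Printing Implicit Defensive.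
Import Order.TTheory GRing.Theory Num.Theory.
Import numFieldNormedType.Exports.
Local Open Scope classical_set_scope.
Local Open Scope ring_scope.

(** Let [y] be the lift attached to a balanced parametrization, with constant
    [a].  For fixed [s] the functions [g t = det (y t, y' s, y s)] and
    [h t = det (y s, y' t, y t)] solve the equation of [y] and its adjoint; by
    strict convexity they are positive on [(s, s + 2 pi)], with double zeros at
    both ends.  The bilinear concomitant of the pair vanishes, which says that
    [f = (g h)^(1/4)] satisfies
    [f'' + (a / 2 + 3 / 16 (g'/g - h'/h)^2) f = 0], so Sturm comparison with
    [sin (t / 2)] gives [a <= 1/2], with equality only if [g'/g = h'/h], whence
    [beta = 0] and [K] is ellipsoidal.

    Hence [a < 1/2].  If [z (sg t) = lam t * y t] relates two balanced lifts,
    then [sg' = lam], and [a = a' lam^2 + S(sg)] with [S] the Schwarzian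
    derivative.  Differentiating, [x = (1 / lam)'] is a periodic solution of
    [x'' + 2 a x = 0], so [x = 0] and [lam] is constant, equal to [1] since both
    curves traverse the boundary once per period. *)

(** * Differentiation rules for real functions *)

Section ScalarDerivatives.
Context {R : realType}.
Implicit Types (f g : R -> R) (t : R).

(* Unlike [is_derive], [hasder] is not a class: derivatives are left as
   unification variables until the derivation rules below fill them in. *)
Definition hasder t f a := is_derive t 1 f a.

Lemma der_eq f t a b : hasder t f a -> a = b -> hasder t f b.
Proof. by move=> + <-. Qed.

Lemma der_ext f g t a : f =1 g -> hasder t f a -> hasder t g a.
Proof. by move=> /funext ->. Qed.

Lemma derC (c : R) t : hasder t (fun _ : R => c) 0.
Proof. exact: is_derive_cst. Qed.

Lemma derid t : hasder t (fun x : R => x) 1.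
Proof. exact: is_derive_id. Qed.

Lemma derD f g t a b : hasder t f a -> hasder t g b ->
  hasder t (fun x => f x + g x) (a + b).
Proof. exact: is_deriveD. Qed.

Lemma derN f t a : hasder t f a -> hasder t (fun x => - f x) (- a).
Proof. exact: is_deriveN. Qed.

Lemma derM f g t a b : hasder t f a -> hasder t g b ->
  hasder t (fun x => f x * g x) (f t * b + g t * a).
Proof. exact: is_deriveM. Qed.

Lemma derX2 f t a : hasder t f a ->
  hasder t (fun x => f x ^+ 2) (2 * f t * a).
Proof.
move=> fa; apply: (der_ext (f := fun x => f x * f x)) => [x|].
  by rewrite expr2.
by apply: der_eq; [exact: (derM fa fa)|ring].
Qed.

Lemma derV f t a : f t != 0 -> hasder t f a ->
  hasder t (fun x => (f x)^-1) (- a / f t ^+ 2).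
Proof.
move=> f0 fa; apply: der_eq (is_deriveV f0 fa) _.
by rewrite /GRing.scale /= mulrC mulrN mulNr.
Qed.

Lemma dersin f t a : hasder t f a ->
  hasder t (fun x => sin (f x)) (cos (f t) * a).
Proof. by move=> fa; exact: (is_derive1_comp (f := @sin R)). Qed.

Lemma dercos f t a : hasder t f a ->
  hasder t (fun x => cos (f x)) (- sin (f t) * a).
Proof. by move=> fa; exact: (is_derive1_comp (f := @cos R)). Qed.

Lemma der_unique f t a b : hasder t f a -> hasder t f b -> a = b.
Proof. by move=> [_ <-] [_ <-]. Qed.

Lemma der_near f g t a : (\forall x \near t, f x = g x) ->
  hasder t f a -> hasder t g a.
Proof.
by move=> fg; exact: near_eq_is_derive.
Qed.

Lemma der_continuous f t a : hasder t f a -> {for t, continuous f}.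
Proof.
move=> [df _]; exact/differentiable_continuous/derivable1_diffP.
Qed.

Lemma der_within f a b (df : R -> R) :
  (forall t, t \in `[a, b]%R -> hasder t f (df t)) ->
  {within `[a, b], continuous f}.
Proof.
move=> d; apply: continuous_in_subspaceT => t; rewrite inE => /d.
exact: der_continuous.
Qed.

Lemma mean_value f (df : R -> R) a b : a < b ->
  (forall t, a <= t <= b -> hasder t f (df t)) ->
  exists2 c, a < c < b & f b - f a = df c * (b - a).
Proof.
move=> ab d.
have [||c] := @MVT _ f df a b ab.
- by move=> x; rewrite in_itv /= => /andP[/ltW ? /ltW ?]; apply: d; apply/andP.
- by apply: (@der_within f a b df) => t; rewrite in_itv; exact: d.
- by rewrite in_itv; exists c.
Qed.

Lemma der0_cst f : (forall t, hasder t f 0) -> forall t u, f t = f u.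
Proof. by move=> d t u; exact: is_derive_0_is_cst. Qed.

Lemma der_at_min f t a : hasder t f a ->
  (forall x, exists d, hasder x f d) -> (forall x, f t <= f x) -> a = 0.
Proof.
move=> fa df m; apply: (der_unique fa).
apply: (@derive1_at_min _ f (t - 1) (t + 1)).
- lra.
- by move=> x _; have [d []] := df x.
- by rewrite in_itv /=; lra.
- by move=> x _; exact: m.
Qed.

End ScalarDerivatives.

(* The partially applied patterns are the eta-short forms that [apply:] leaves
   behind. *)
Ltac der1 :=
  lazymatch goal with
  | |- hasder _ (fun _ => ?c) _ => apply: derC
  | |- hasder _ (fun x => x) _ => apply: derid
  | |- hasder _ id _ => apply: derid
  | |- hasder _ (fun x => _ + _) _ => apply: derD
  | |- hasder _ (+%R _) _ => apply: derD
  | |- hasder _ (fun x => - _) _ => apply: derN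
  | |- hasder _ -%R _ => apply: derN
  | |- hasder _ (fun x => _ ^+ 2) _ => apply: derX2
  | |- hasder _ (fun x => _ * _) _ => apply: derM
  | |- hasder _ ( *%R _) _ => apply: derM
  | |- hasder _ (fun x => sin _) _ => apply: dersin
  | |- hasder _ sin _ => apply: dersin
  | |- hasder _ (fun x => cos _) _ => apply: dercos
  | |- hasder _ cos _ => apply: dercos
  | H : hasder ?t ?f _ |- hasder ?t ?f _ => exact: H
  end.

Ltac der := repeat der1.

Ltac der_ring := apply: der_eq; [by der | rewrite /=; ring].

(** * Determinants and derivatives of curves in three-space *)

Section Vectors.
Context {R : realType}.
Notation V := 'rV[R]_3.
Implicit Types (a b c x : V) (f g : R -> V).

Lemma ord3_ind (P : 'I_3 -> Prop) : P 0 -> P 1 -> P 2 -> forall i, P i.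
Proof.
move=> P0 P1 P2 [[|[|[|//]]] Hi].
- by rewrite (_ : Ordinal Hi = 0) //; apply/val_inj.
- by rewrite (_ : Ordinal Hi = 1) //; apply/val_inj.
- by rewrite (_ : Ordinal Hi = 2) //; apply/val_inj.
Qed.

Lemma rV3P a b : a 0 0 = b 0 0 -> a 0 1 = b 0 1 -> a 0 2 = b 0 2 -> a = b.
Proof.
by move=> e0 e1 e2; apply/rowP; apply: ord3_ind.
Qed.

Lemma det_mx22 (M : 'M[R]_2) : \det M = M 0 0 * M 1 1 - M 0 1 * M 1 0.
Proof.
have o1 : lift (0 : 'I_2) (0 : 'I_1) = 1 by apply/val_inj.
have o2 : lift (1 : 'I_2) (0 : 'I_1) = 0 by apply/val_inj.
rewrite (expand_det_row _ 0) !big_ord_recl big_ord0 /cofactor !det_mx11 !mxE /=.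
have -> : lift (ord0 : 'I_2) (ord0 : 'I_1) = 1 by apply/val_inj.
have -> : ord0 = 0 :> 'I_2 by apply/val_inj.
by rewrite ?o1 ?o2 /= expr0 expr1; ring.
Qed.

Lemma det3E a b c : det3 a b c =
  a 0 0 * (b 0 1 * c 0 2 - b 0 2 * c 0 1)
  - a 0 1 * (b 0 0 * c 0 2 - b 0 2 * c 0 0)
  + a 0 2 * (b 0 0 * c 0 1 - b 0 1 * c 0 0).
Proof.
have o1 : lift (0 : 'I_3) (0 : 'I_2) = 1 by apply/val_inj.
have o2 : lift (0 : 'I_3) (1 : 'I_2) = 2 by apply/val_inj.
have o3 : lift (1 : 'I_3) (0 : 'I_2) = 0 by apply/val_inj.
have o4 : lift (1 : 'I_3) (1 : 'I_2) = 2 by apply/val_inj.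
have o5 : lift (2 : 'I_3) (0 : 'I_2) = 0 by apply/val_inj.
have o6 : lift (2 : 'I_3) (1 : 'I_2) = 1 by apply/val_inj.
rewrite /det3 (expand_det_row _ 0) !big_ord_recl big_ord0 /cofactor !det_mx22 !mxE /=.
have -> : lift (ord0 : 'I_3) (ord0 : 'I_2) = 1 by apply/val_inj.
have -> : lift (ord0 : 'I_3) (lift (ord0 : 'I_2) (ord0 : 'I_1)) = 2 by apply/val_inj.
have -> : ord0 = 0 :> 'I_3 by apply/val_inj.
rewrite ?o1 ?o2 ?o3 ?o4 ?o5 ?o6 /=.
by rewrite expr0 expr1 sqrrN expr1n; ring.
Qed.

Definition vder f (t : R) a := forall i, hasder t (fun u => f u 0 i) (a 0 i).

Lemma vderP f t : derivable f t 1 -> vder f t (derive1 f t).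
Proof.
move=> df i; split; first by move/derivable_mxP: df => /(_ 0 i).
by rewrite derive1E derive_mx // mxE.
Qed.

Lemma der_det3 f g (h : R -> V) t a b c :
  vder f t a -> vder g t b -> vder h t c ->
  hasder t (fun u => det3 (f u) (g u) (h u))
    (det3 a (g t) (h t) + det3 (f t) b (h t) + det3 (f t) (g t) c).
Proof.
move=> fa gb hc; rewrite (funext (fun u => det3E (f u) (g u) (h u))).
have [f0 f1 f2] := And3 (fa 0) (fa 1) (fa 2).
have [g0 g1 g2] := And3 (gb 0) (gb 1) (gb 2).
have [h0 h1 h2] := And3 (hc 0) (hc 1) (hc 2).
apply: der_eq; first by der.
rewrite !det3E; ring.
Qed.

Lemma vderC a t : vder (fun=> a) t 0.
Proof. by move=> i; rewrite mxE; exact: derC. Qed.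

Lemma vderD f g t a b : vder f t a -> vder g t b ->
  vder (fun u => f u + g u) t (a + b).
Proof.
move=> fa gb i; rewrite mxE.
apply: (der_ext (f := fun u => f u 0 i + g u 0 i)) => [u|]; first by rewrite mxE.
exact: derD.
Qed.

Lemma vderZ (l : R -> R) f t (m : R) a : hasder t l m -> vder f t a ->
  vder (fun u => l u *: f u) t (m *: f t + l t *: a).
Proof.
move=> lm fa i; rewrite !mxE.
apply: (der_ext (f := fun u => l u * f u 0 i)) => [u|]; first by rewrite mxE.
by apply: der_eq; [exact: (derM lm (fa i))|rewrite /=; ring].
Qed.

Lemma vder_unique f t a b : vder f t a -> vder f t b -> a = b.
Proof. by move=> fa fb; apply/rowP => i; exact: der_unique (fa i) (fb i). Qed.

Lemma vder_ext f g t a : f =1 g -> vder f t a -> vder g t a.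
Proof. by move=> /funext ->. Qed.

Lemma det3_decomp a b c x :
  det3 a b c *: x = det3 x b c *: a + det3 a x c *: b + det3 a b x *: c.
Proof. by apply: rV3P; rewrite !mxE !det3E; ring. Qed.

Lemma det3Zl (k : R) a b c : det3 (k *: a) b c = k * det3 a b c.
Proof. by rewrite !det3E !mxE; ring. Qed.

End Vectors.

(** * Reduction modulo the period *)

Section Periodicity.
Context {R : realType}.

Lemma reduce_mod_2pi (s t : R) : exists n : int,
  s <= t + n%:~R * (2 * pi) < s + 2 * pi.
Proof.
have pp := pi_gt0 R.
exists (- Num.floor ((t - s) / (2 * pi))).
have /andP[] := mem_rg1_floor ((t - s) / (2 * pi)).
rewrite ler_pdivlMr ?mulr_gt0 // ltr_pdivrMr ?mulr_gt0 // intrN; lra.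
Qed.

Lemma periodic_int (U : Type) (f : R -> U) : (forall t, f (t + 2 * pi) = f t) ->
  forall (n : int) t, f (t + n%:~R * (2 * pi)) = f t.
Proof.
move=> fp.
have fn (n : nat) t : f (t + n%:R * (2 * pi)) = f t.
  elim: n => [|n IH]; first by rewrite mul0r addr0.
  by rewrite -natr1 mulrDl mul1r addrA fp.
case=> n t; first exact: fn.
by rewrite NegzE mulrNz mulNr -[LHS](fn n.+1) subrK.
Qed.

(** After reduction to [[0, 2 pi)], a nonzero angle has a half-angle with positive sine, while the
    double angle formula makes that sine vanish. *)
Lemma cos_eq1 (x : R) : cos x = 1 -> exists n : int, x = n%:~R * (2 * pi).
Proof.
have [n /andP[n0 n1]] := reduce_mod_2pi 0 x.
have cp : forall t : R, cos (t + 2 * pi) = cos t.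
  by move=> t; rewrite mulr_natl cosD2pi.
rewrite -(periodic_int cp n) => c1.
set u := x + _ in n0 n1 c1.
suff u0 : u = 0 by exists (- n); rewrite intrN mulNr; move: u0; rewrite /u; lra.
have [//|une0] := eqVneq u 0.
have : 0 < sin (u / 2).
  have u0 : 0 < u by rewrite lt_neqAle eq_sym une0.
  clearbody u; apply: sin_gt0_pi; apply/andP; split; lra.
have : sin (u / 2) ^+ 2 = 0.
  have : cos u = cos (u / 2) ^+ 2 *+ 2 - 1.
    by rewrite -cos_mulr2n; congr cos; rewrite mulr2n; lra.
  by rewrite sin2cos2 c1 mulr2n; lra.
by move=> /eqP; rewrite sqrf_eq0 => /eqP ->; rewrite ltxx.
Qed.

End Periodicity.

(** * Signs to the right of a zero *)

Section Signs.
Context {R : realType}.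
Implicit Types f : R -> R.

Lemma der_comp_affine f (s k e d : R) : hasder (s + k * e) f d ->
  hasder e (fun u => f (s + k * u)) (k * d).
Proof.
move=> fd; have h : hasder e (fun u => s + k * u) k.
  by der_ring.
by apply: der_eq; [exact: (is_derive1_comp (g := fun u => s + k * u) fd h)|ring].
Qed.

Lemma der_neg_right f a s : hasder s f a -> f s = 0 -> a < 0 ->
  \forall e \near 0^'+, f (s + e) < 0.
Proof.
move=> /is_derive1_caratheodory[g [fE cg ga]] fs0 a0.
rewrite -ga in a0; rewrite near_withinE.
have /nbhs_ballP[d /= d0 dP] : \forall x \near s, g x < 0.
  exact: cvgr_lt cg _ a0.
apply/nbhs_ballP; exists d => //= e; rewrite /ball /= sub0r normrN => ed e0.
have := fE (s + e); rewrite fs0 subr0 => ->.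
rewrite nmulr_rlt0; first by lra.
by apply: dP; rewrite /ball /= opprD addrA subrr sub0r normrN.
Qed.

(** By the mean value theorem; iterating it carries the sign of a higher derivative down to the
    function. *)
Lemma neg_right_integrate f (df : R -> R) : f 0 = 0 ->
  (forall t, hasder t f (df t)) ->
  (\forall e \near 0^'+, df e < 0) -> \forall e \near 0^'+, f e < 0.
Proof.
move=> f0 fd; rewrite !near_withinE => /nbhs_ballP[d /= d0 dP].
apply/nbhs_ballP; exists d => //= e; rewrite /ball /= sub0r normrN => ed e0.
have [c /andP[c0 ce]] := mean_value e0 (fun t _ => fd t).
rewrite f0 !subr0 => ->; rewrite pmulr_llt0 //; apply: dP => //.
by rewrite /ball /= sub0r normrN; move: ed; rewrite !gtr0_norm; lra.
Qed.

End Signs.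

(** * Rays, and simplicial cones inside a convex cone *)

Section Cones.
Context {R : realType}.
Notation V := 'rV[R]_3.
Implicit Types (K : set V) (u v w x : V).

Lemma same_ray_refl x : same_ray x x.
Proof. by exists 1; rewrite scale1r. Qed.

Lemma same_ray_sym x v : same_ray x v -> same_ray v x.
Proof.
move=> [l [l0 ->]]; exists l^-1; split; first by rewrite invr_gt0.
by rewrite scalerA mulVf ?scale1r // gt_eqF.
Qed.

Lemma same_ray_trans x v w : same_ray x v -> same_ray v w -> same_ray x w.
Proof.
move=> [l [l0 ->]] [m [m0 ->]]; exists (m * l); split; first by rewrite mulr_gt0.
by rewrite scalerA.
Qed.

Lemma linear_form_continuous u v : continuous (fun x : V => det3 x u v).
Proof.
rewrite (funext (fun x => det3E x u v)) => x.
have c i (k : R) : {for x, continuous (fun z : V => z 0 i * k)}.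
  exact: (cvgM (@coord_continuous R 1 3 0 i x) (cvg_cst k)).
exact: (cvgD (cvgB (c 0 (u 0 1 * v 0 2 - u 0 2 * v 0 1))
                   (c 1 (u 0 0 * v 0 2 - u 0 2 * v 0 0)))
             (c 2 (u 0 0 * v 0 1 - u 0 1 * v 0 0))).
Qed.

(** By Cramer's rule the coordinates of a vector in the frame [u], [v], [w] are quotients of these
    determinants; they are positive at [x], hence near [x]. *)
Lemma simplicial_cone_interior K u v w x : regular_convex_cone K ->
  K u -> K v -> K w -> det3 u v w < 0 ->
  det3 x v w < 0 -> det3 u x w < 0 -> det3 u v x < 0 -> interior K x.
Proof.
move=> [_ KD KZ _ _] Ku Kv Kw d0 d1 d2 d3.
have c1 : {for x, continuous (fun z : V => det3 z v w)}.
  exact: linear_form_continuous.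
have c2 : {for x, continuous (fun z : V => det3 u z w)}.
  rewrite (_ : (fun z => _) = (fun z => det3 z w u)).
    exact: linear_form_continuous.
  by apply/funext => z; rewrite !det3E; ring.
have c3 : {for x, continuous (fun z : V => det3 u v z)}.
  rewrite (_ : (fun z => _) = (fun z => det3 z u v)).
    exact: linear_form_continuous.
  by apply/funext => z; rewrite !det3E; ring.
rewrite /interior /=; near=> z.
have e1 : det3 z v w < 0 by near: z; exact: cvgr_lt _ c1 _ d1.
have e2 : det3 u z w < 0 by near: z; exact: cvgr_lt _ c2 _ d2.
have e3 : det3 u v z < 0 by near: z; exact: cvgr_lt _ c3 _ d3.
have -> : z = (det3 z v w / det3 u v w) *: u + (det3 u z w / det3 u v w) *: v
            + (det3 u v z / det3 u v w) *: w.
  have := det3_decomp u v w z.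
  move=> /(congr1 (fun t => (det3 u v w)^-1 *: t)).
  rewrite scalerA mulVf ?lt_eqF // scale1r !scalerDr !scalerA => {1}->.
  by rewrite ![(det3 u v w)^-1 * _]mulrC.
by apply: (KD); [apply: (KD)|]; apply: (KZ) => //; rewrite ltW // nmulr_rgt0 // invr_lt0.
Unshelve. all: by end_near. Qed.

End Cones.

(** * Balanced lifts and their supporting planes *)

Section Support.
Context {R : realType}.
Notation V := 'rV[R]_3.

(** The derivatives [y1] and [y2] are data, and the third-order equation is solved for the
    derivative of [y2], with [a] constant. Rays are compared on one period only. *)
Record balanced_lift (K : set V) (y y1 y2 : R -> V) (a : R) (b : R -> R) : Prop :=
  BalancedLift {
  blift_cone : regular_convex_cone K;
  blift_bd : forall t, bd K (y t);
  blift_neq0 : forall t, y t != 0;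
  blift_periodic : forall t, y (t + 2 * pi) = y t;
  blift_surj : forall x, bd K x -> x != 0 ->
    exists2 t, 0 <= t < 2 * pi & same_ray (y t) x;
  blift_inj : forall t t', 0 <= t < 2 * pi -> 0 <= t' < 2 * pi ->
    same_ray (y t) (y t') -> t = t';
  blift_d0 : forall t, vder y t (y1 t);
  blift_d1 : forall t, vder y1 t (y2 t);
  blift_d2 : forall t, vder y2 t (- (2 * a) *: y1 t - b t *: y t);
  blift_det : forall t, det3 (y2 t) (y1 t) (y t) = 1 }.

Lemma vder_addl (f : R -> V) (s e : R) d : vder f (s + e) d ->
  vder (fun u => f (s + u)) e d.
Proof.
move=> fd i; have := @der_comp_affine _ (fun u => f u 0 i) s 1 e (d 0 i).
rewrite !mul1r => /(_ (fd i)).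
by apply: der_ext => u; rewrite mul1r.
Qed.

Lemma vder_subl (f : R -> V) (s e : R) d : vder f (s - e) d ->
  vder (fun u => f (s - u)) e (- d).
Proof.
move=> fd i; have := @der_comp_affine _ (fun u => f u 0 i) s (-1) e (d 0 i).
rewrite !mulN1r => /(_ (fd i)); rewrite mxE.
by apply: der_ext => u; rewrite mulN1r.
Qed.

Variables (K : set V) (y y1 y2 : R -> V) (a : R) (b : R -> R).
Hypothesis L : balanced_lift K y y1 y2 a b.

Let Ky t : K (y t). Proof. by case: (blift_bd L t). Qed.

(** Since [det (y'', y', y) = 1], Taylor expansion gives the leading term [- e ^ 3]: the determinant
    and its first two derivatives [f1], [f2] vanish at [e = 0], and the third derivative is [-6]. *)
Lemma chord_det_lt0 s : \forall e \near 0^'+, det3 (y (s + e)) (y (s - e)) (y s) < 0.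
Proof.
have p0 e := vder_addl (blift_d0 L (s + e)).
have p1 e := vder_addl (blift_d1 L (s + e)).
have p2 e := vder_addl (blift_d2 L (s + e)).
have m0 e := vder_subl (blift_d0 L (s - e)).
have m1 e := vder_subl (blift_d1 L (s - e)).
have m2 e := vder_subl (blift_d2 L (s - e)).
have c e := vderC (y s) e.
pose f2 e := det3 (y2 (s + e)) (y (s - e)) (y s)
    - 2 * det3 (y1 (s + e)) (y1 (s - e)) (y s)
    + det3 (y (s + e)) (y2 (s - e)) (y s).
pose f1 e := det3 (y1 (s + e)) (y (s - e)) (y s)
    - det3 (y (s + e)) (y1 (s - e)) (y s).
apply: (@neg_right_integrate _ _ f1) => [|e|].
- by rewrite addr0 subr0 !det3E; ring.
- apply: der_eq (der_det3 (p0 e) (m0 e) (c e)) _.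
  by rewrite /f1 !det3E !mxE; ring.
apply: (@neg_right_integrate _ _ f2) => [|e|].
- by rewrite /f1 addr0 subr0 !det3E; ring.
- have h1 := der_det3 (p1 e) (m0 e) (c e).
  have h2 := der_det3 (p0 e) (m1 e) (c e).
  apply: der_eq (derD h1 (derN h2)) _.
  by rewrite /f2 !det3E !mxE; ring.
rewrite -[f2]/(fun e => f2 e) (_ : (fun e => f2 e) = fun e => f2 (0 + e)); last first.
  by apply/funext => e; rewrite add0r.
apply: (@der_neg_right _ _ (-6)).
- have h1 := der_det3 (p2 0) (m0 0) (c 0).
  have h2 := der_det3 (p1 0) (m1 0) (c 0).
  have h3 := der_det3 (p0 0) (m2 0) (c 0).
  apply: der_eq (derD (derD h1 (derN (derM (derC 2 0) h2))) h3) _.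
  have -> : -6 = -6 * det3 (y2 s) (y1 s) (y s) by rewrite (blift_det L) mulr1.
  rewrite /= !addr0 !subr0 !det3E !mxE; ring.
- by rewrite /f2 addr0 subr0 !det3E; ring.
- by lra.
Qed.

(* If the form were negative at [x], then [y s] would be a positive combination
   of [x], [y (s + e)] and [y (s - e)], hence interior to [K]. *)
Lemma support_ge0 s x : K x -> 0 <= det3 x (y1 s) (y s).
Proof.
move=> Kx; rewrite leNgt; apply/negP => neg.
have [_] := blift_bd L s; apply.
have c x' e := @vderC R x' e.
have d0 t := blift_d0 L t.
(* The three determinants [nA], [nB], [nC] vanish at [e = 0], with derivatives 1, 1 and 2 times the
   negative value of the form at [x]. The fourth sign is that of the chord determinant. *)
have nA : \forall e \near 0^'+, det3 (y (s + e)) (y s) x < 0.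
  apply: (@der_neg_right _ (fun u => det3 (y u) (y s) x) (det3 x (y1 s) (y s))) => //.
    apply: der_eq (der_det3 (d0 s) (c _ _) (c _ _)) _.
    by rewrite !det3E !mxE; ring.
  by rewrite !det3E; ring.
have nB : \forall e \near 0^'+, det3 (y s) (y (s - e)) x < 0.
  apply: (@filterS _ _ _ (fun e => det3 (y s) (y (s - (0 + e))) x < 0)) => [e|].
    by rewrite add0r.
  apply: (@der_neg_right _ (fun u => det3 (y s) (y (s - u)) x) (det3 x (y1 s) (y s))) => //.
    have m0 := vder_subl (blift_d0 L (s - 0)).
    apply: der_eq (der_det3 (c _ _) m0 (c _ _)) _.
    by rewrite subr0 !det3E !mxE; ring.
  by rewrite subr0 !det3E; ring.
have nC : \forall e \near 0^'+, det3 (y (s + e)) (y (s - e)) x < 0.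
  apply: (@filterS _ _ _
    (fun e => det3 (y (s + (0 + e))) (y (s - (0 + e))) x < 0)) => [e|].
    by rewrite add0r.
  apply: (@der_neg_right _ (fun u => det3 (y (s + u)) (y (s - u)) x) (2 * det3 x (y1 s) (y s))) => //.
  - have m0 := vder_subl (blift_d0 L (s - 0)).
    have p0 := vder_addl (blift_d0 L (s + 0)).
    apply: der_eq (der_det3 p0 m0 (c _ _)) _.
    by rewrite subr0 addr0 !det3E !mxE; ring.
  - by rewrite subr0 addr0 !det3E; ring.
  - by lra.
have nD := chord_det_lt0 s.
have [e [[e1 e2] [e3 e4]]] : exists e,
    (det3 (y (s + e)) (y s) x < 0 /\ det3 (y s) (y (s - e)) x < 0) /\
    (det3 (y (s + e)) (y (s - e)) x < 0 /\ det3 (y (s + e)) (y (s - e)) (y s) < 0).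
  apply: (@filter_ex _ (0^'+ : set_system R)).
  by apply: filterI; apply: filterI.
exact: (simplicial_cone_interior (blift_cone L) (Ky _) (Ky _) Kx e3 e2 e1 e4).
Qed.

End Support.

(** * Quadratic bounds at a double zero *)

Section SecondOrder.
Context {R : realType}.

(** Here [f1 x = G x * (x - s)] with [G] continuous and [G s = 1], so [1/2 < G < 3/2] near [s]. The
    bounds isolate the zero and control [f1 / f] there. *)
Lemma double_zero_bounds (f f1 : R -> R) (s : R) :
  (forall t, hasder t f (f1 t)) -> hasder s f1 1 -> f s = 0 -> f1 s = 0 ->
  exists2 e, 0 < e & forall r, `|r - s| < e ->
    (r - s) ^+ 2 / 4 <= f r /\ `|f1 r| <= 2 * `|r - s|.
Proof.
move=> fd /is_derive1_caratheodory[G [GE cG Gs]] fs f1s.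
have /nbhs_ballP[e /= e0 eP] : \forall x \near s, `|G s - G x| < 2^-1.
  by move/cvgrPdist_lt: cG; apply; lra.
have GE' x : f1 x = G x * (x - s) by rewrite -GE f1s subr0.
have Gb r : `|r - s| < e -> 2^-1 < G r < 3 / 2.
  by move=> re; have := eP r; rewrite Gs /ball /= distrC => /(_ re); rewrite ltr_norml; lra.
exists e => // r re; split; last first.
  rewrite GE' normrM ler_wpM2r //.
  by have /andP[? ?] := Gb r re; rewrite ger0_norm; lra.
(* The derivative of [F] is [(G x - 1/2) * (x - s)], so [F] has a local minimum, equal to 0, at
   [s]. *)
pose F x := f x - (x - s) ^+ 2 / 4.
have Fd x : hasder x F ((G x - 2^-1) * (x - s)).
  have := fd x; rewrite GE' => fx.
  apply: der_eq; first by rewrite /F; der.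
  by rewrite /=; lra.
have Fs : F s = 0 by rewrite /F fs subrr expr0n /= mul0r subr0.
suff : 0 <= F r by rewrite /F subr_ge0.
case: (ltgtP s r) => [sr|rs|<-]; last by rewrite Fs.
- have [c /andP[c0 c1]] := mean_value sr (fun t _ => Fd t).
  rewrite Fs subr0 => ->; have /andP[? ?] : 2^-1 < G c < 3 / 2.
    by apply: Gb; move: re; rewrite !gtr0_norm; lra.
  by rewrite !mulr_ge0 //; lra.
- have [c /andP[c0 c1]] := mean_value rs (fun t _ => Fd t).
  have /andP[? ?] : 2^-1 < G c < 3 / 2.
    by apply: Gb; move: re; rewrite !ltr0_norm; lra.
  rewrite Fs sub0r => FE.
  suff : 0 <= (G c - 2^-1) * (s - c) * (s - r) by move: FE; lra.
  by rewrite !mulr_ge0 //; lra.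
Qed.

End SecondOrder.

(** * Parallel vectors and rays *)

Section Rays.
Context {R : realType}.
Notation V := 'rV[R]_3.
Implicit Types x z : V.

Definition sqnorm x := x 0 0 ^+ 2 + x 0 1 ^+ 2 + x 0 2 ^+ 2.

(** The squared length of the cross product, a smooth measure of how far [x] and [z] are from
    parallel. *)
Definition sqcross x z :=
  (x 0 1 * z 0 2 - x 0 2 * z 0 1) ^+ 2 + (x 0 0 * z 0 2 - x 0 2 * z 0 0) ^+ 2
  + (x 0 0 * z 0 1 - x 0 1 * z 0 0) ^+ 2.

Lemma sqnorm_gt0 x : x != 0 -> 0 < sqnorm x.
Proof.
move=> x0; have : 0 <= sqnorm x by rewrite !addr_ge0 ?sqr_ge0.
rewrite le_eqVlt => /orP[/eqP|//] /esym n0; case/negP: x0; apply/eqP.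
have := sqr_ge0 (x 0 0); have := sqr_ge0 (x 0 1); have := sqr_ge0 (x 0 2).
rewrite /sqnorm in n0 => h2 h1 h0.
by apply: rV3P; rewrite mxE; apply/eqP; rewrite -sqrf_eq0; apply/eqP; lra.
Qed.

Lemma sqcross_ge0 x z : 0 <= sqcross x z.
Proof. by rewrite !addr_ge0 ?sqr_ge0. Qed.

(** The factor [k] is that of the orthogonal projection of [z] on [x]: the components of
    [|x|^2 z - <x, z> x] are combinations of those of the cross product. *)
Lemma sqcross_eq0 x z : x != 0 -> sqcross x z = 0 -> exists k, z = k *: x.
Proof.
move=> x0; rewrite /sqcross.
set p := x 0 1 * _ - _; set q := x 0 0 * _ - _; set r := x 0 0 * _ - _.
have := sqr_ge0 p; have := sqr_ge0 q; have := sqr_ge0 r => h3 h2 h1 h.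
have p0 : p = 0 by apply/eqP; rewrite -sqrf_eq0; apply/eqP; lra.
have q0 : q = 0 by apply/eqP; rewrite -sqrf_eq0; apply/eqP; lra.
have r0 : r = 0 by apply/eqP; rewrite -sqrf_eq0; apply/eqP; lra.
have n0 := lt0r_neq0 (sqnorm_gt0 x0).
exists ((x 0 0 * z 0 0 + x 0 1 * z 0 1 + x 0 2 * z 0 2) / sqnorm x).
rewrite /p /q /r in p0 q0 r0.
apply: rV3P; rewrite mxE; apply: (mulfI n0);
  rewrite mulrA [sqnorm x * (_ / _)]mulrC divfK // /sqnorm.
- suff : sqnorm x * z 0 0 = (x 0 0 * z 0 0 + x 0 1 * z 0 1 + x 0 2 * z 0 2) * x 0 0
    - x 0 2 * (x 0 0 * z 0 2 - x 0 2 * z 0 0) - x 0 1 * (x 0 0 * z 0 1 - x 0 1 * z 0 0).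
    by rewrite q0 r0 !mulr0 !subr0.
  by rewrite /sqnorm; ring.
- suff : sqnorm x * z 0 1 = (x 0 0 * z 0 0 + x 0 1 * z 0 1 + x 0 2 * z 0 2) * x 0 1
    - x 0 2 * (x 0 1 * z 0 2 - x 0 2 * z 0 1) + x 0 0 * (x 0 0 * z 0 1 - x 0 1 * z 0 0).
    by rewrite p0 r0 !mulr0 subr0 addr0.
  by rewrite /sqnorm; ring.
- suff : sqnorm x * z 0 2 = (x 0 0 * z 0 0 + x 0 1 * z 0 1 + x 0 2 * z 0 2) * x 0 2
    + x 0 1 * (x 0 1 * z 0 2 - x 0 2 * z 0 1) + x 0 0 * (x 0 0 * z 0 2 - x 0 2 * z 0 0).
    by rewrite p0 q0 !mulr0 !addr0.
  by rewrite /sqnorm; ring.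
Qed.

Lemma sqnormZ k x : sqnorm (k *: x) = k ^+ 2 * sqnorm x.
Proof. by rewrite /sqnorm !mxE; ring. Qed.

Lemma sqcrossZ k x z : sqcross (k *: x) z = k ^+ 2 * sqcross x z.
Proof. by rewrite /sqcross !mxE; ring. Qed.

(** A nonpositive factor would put [- x] in [K], which contains no line. *)
Lemma parallel_same_ray (K : set V) x z k : regular_convex_cone K ->
  K x -> K z -> x != 0 -> z != 0 -> z = k *: x -> same_ray x z.
Proof.
move=> [_ _ KZ _ Kpt] Kx Kz x0 z0 zE; exists k; split => //.
rewrite ltNge; apply/negP => k0.
case/negP: x0; apply/eqP/Kpt => //.
have kn0 : k != 0 by apply: contraNneq z0 => ke; rewrite zE ke scale0r.
have -> : - x = (- k^-1) *: z by rewrite zE scalerA mulNr mulVf // scaleN1r.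
by apply: KZ => //; rewrite oppr_ge0 invr_le0.
Qed.

End Rays.

(** * Strict convexity of the boundary curve *)

Section StrictConvexity.
Context {R : realType}.
Notation V := 'rV[R]_3.
Variables (K : set V) (y y1 y2 : R -> V) (a : R) (b : R -> R).
Hypothesis L : balanced_lift K y y1 y2 a b.

Lemma lift_in t : K (y t). Proof. by case: (blift_bd L t). Qed.

Lemma lift_not_same_ray t t' : 0 < t' - t < 2 * pi -> ~ same_ray (y t) (y t').
Proof.
move=> tt'; have [n /andP[n0 n1]] := reduce_mod_2pi 0 t.
have yp := periodic_int (blift_periodic L) n.
rewrite -(yp t) -(yp t') => sr.
(* With [t] moved into [[0, 2 pi)], the image of [t'] may fall into the next period; it is then
   moved back by [2 pi]. *)
have [lt|ge] := ltP (t' + n%:~R * (2 * pi)) (2 * pi).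
  suff : t + n%:~R * (2 * pi) = t' + n%:~R * (2 * pi) by lra.
  by apply: (blift_inj L) => //; lra.
suff : t + n%:~R * (2 * pi) = t' + n%:~R * (2 * pi) - 2 * pi by lra.
apply: (blift_inj L); [lra|lra|].
by rewrite -(blift_periodic L (_ - _)) subrK.
Qed.

Lemma lift_surj_from s x : bd K x -> x != 0 ->
  exists2 t, s <= t < s + 2 * pi & same_ray (y t) x.
Proof.
move=> bx x0; have [t _ sr] := blift_surj L bx x0.
have [n tn] := reduce_mod_2pi s t.
exists (t + n%:~R * (2 * pi)) => //.
by rewrite periodic_int //; exact: blift_periodic L.
Qed.

Lemma lift_sqcross_gt0 t t' : 0 < t' - t < 2 * pi -> 0 < sqcross (y t') (y t).
Proof.
move=> tt'; rewrite lt_neqAle sqcross_ge0 andbT; apply/eqP => /esym c0.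
have [k yE] := sqcross_eq0 (blift_neq0 L t') c0.
apply: (lift_not_same_ray tt'); apply: same_ray_sym.
exact: (parallel_same_ray (blift_cone L) (lift_in _) (lift_in _)
  (blift_neq0 L _) (blift_neq0 L _) yE).
Qed.

(** The quotient of [sqcross] by [sqnorm] is continuous and positive on a compact interval; [m] is
    its minimum. *)
Lemma lift_separation s e : 0 < e -> e <= pi ->
  exists2 m, 0 < m & forall t, s + e <= t <= s + 2 * pi - e ->
    m * sqnorm (y t) <= sqcross (y t) (y s).
Proof.
move=> e0 epi.
have ab : s + e <= s + 2 * pi - e by lra.
pose f t := sqcross (y t) (y s) * (sqnorm (y t))^-1.
have n0 t := sqnorm_gt0 (blift_neq0 L t).
have fd t : exists d, hasder t f d.
  have h0 := blift_d0 L t 0; have h1 := blift_d0 L t 1; have h2 := blift_d0 L t 2.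
  eexists; rewrite /f; apply: derM; last apply: derV.
  - by rewrite /sqcross; der.
  - by rewrite gt_eqF.
  - by rewrite /sqnorm; der.
have cf : {within `[s + e, s + 2 * pi - e], continuous f}.
  apply: continuous_in_subspaceT => t _.
  by have [d /der_continuous] := fd t.
have [c] := EVT_min ab cf; rewrite in_itv /= => cab cmin.
exists (f c).
  by rewrite /f mulr_gt0 ?invr_gt0 ?n0 //; apply: lift_sqcross_gt0; lra.
move=> t tab; rewrite -ler_pdivlMr ?n0 //; apply: cmin.
by rewrite in_itv.
Qed.

(** Serves as continuity of the inverse of the map from parameters to rays: a ray close to that of
    [y s] has its parameter close to [s]. *)
Lemma lift_localize s e : 0 < e -> e <= pi ->
  exists2 m, 0 < m & forall x t, same_ray (y t) x ->
    sqcross x (y s) < m * sqnorm x -> s - pi <= t < s + pi -> `|t - s| < e.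
Proof.
move=> e0 epi; have [m m0 mP] := lift_separation s e0 epi.
exists m => // x t [l [l0 ->]]; rewrite sqcrossZ sqnormZ mulrCA.
rewrite ltr_pM2l ?exprn_gt0 // => lt ts; rewrite ltNge; apply/negP => ge.
have [st|st] := leP s t.
  rewrite ger0_norm ?subr_ge0 // in ge.
  have /(lt_le_trans lt) : m * sqnorm (y t) <= sqcross (y t) (y s).
    by apply: mP; lra.
  by rewrite ltxx.
rewrite ltr0_norm ?subr_lt0 // in ge.
have /(lt_le_trans lt) : m * sqnorm (y t) <= sqcross (y t) (y s).
  by rewrite -(blift_periodic L); apply: mP; lra.
by rewrite ltxx.
Qed.

Lemma support_self_bounds s : exists2 e, 0 < e & forall r, `|r - s| < e ->
  (r - s) ^+ 2 / 4 <= det3 (y r) (y1 s) (y s) /\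
  `|det3 (y1 r) (y1 s) (y s)| <= 2 * `|r - s|.
Proof.
have c x t := @vderC R x t.
apply: (@double_zero_bounds _ (fun r => det3 (y r) (y1 s) (y s))
  (fun r => det3 (y1 r) (y1 s) (y s))).
- move=> t; apply: der_eq (der_det3 (blift_d0 L t) (c _ _) (c _ _)) _.
  by rewrite !det3E !mxE; ring.
- apply: der_eq (der_det3 (blift_d1 L s) (c _ _) (c _ _)) _.
  by rewrite -[RHS](blift_det L s) !det3E !mxE; ring.
- by rewrite !det3E; ring.
- by rewrite !det3E; ring.
Qed.

(** Moving from [x] along [- y2 s] lowers the form at unit rate, so an interior [x] would give
    points of [K] where the form is negative. *)
Lemma support_zero_not_interior s x : det3 x (y1 s) (y s) = 0 -> ~ interior K x.
Proof.
move=> x0 ix.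
have cx : {for (0 : R), continuous (fun d : R => x - d *: y2 s)}.
  move=> ?; apply: cvgB; first exact: cvg_cst.
  exact: scalel_continuous.
have : \forall d \near (0 : R), K (x - d *: y2 s).
  by apply: cx; rewrite scale0r subr0.
move=> /nbhs_ballP[e /= e0 eP].
have : K (x - (e / 2) *: y2 s).
  by apply: eP; rewrite /ball /= sub0r normrN gtr0_norm; lra.
move=> /(support_ge0 L s).
rewrite (_ : det3 _ _ _ = det3 x (y1 s) (y s) - e / 2 * det3 (y2 s) (y1 s) (y s)).
  by rewrite x0 (blift_det L); lra.
by rewrite !det3E !mxE; ring.
Qed.

(* If the form vanished at [y t], then [y s + u *: y t] would lie on the boundary
   for small [u > 0], giving zeros of the form near the isolated zero [s]. *)
Lemma support_gt0 s t : 0 < t - s < 2 * pi -> 0 < det3 (y t) (y1 s) (y s).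
Proof.
move=> ts; rewrite lt_neqAle (support_ge0 L) ?andbT; last exact: lift_in.
apply/eqP => /esym g0.
have [_ KD KZ _ Kpt] := blift_cone L.
have [e e0 eP] := support_self_bounds s.
(* Small enough both for the quadratic bound at [s] and for localization, which needs a radius of at
   most [pi]. *)
pose e' := Num.min e pi.
have e'0 : 0 < e' by rewrite lt_min e0 pi_gt0.
have e'pi : e' <= pi by rewrite ge_min lexx orbT.
have [m m0 mP] := lift_localize s e'0 e'pi.
pose x u : V := y s + u *: y t.
have [u u0 xu] : exists2 u, 0 < u & sqcross (x u) (y s) < m * sqnorm (x u).
  pose f u := sqcross (x u) (y s) + - (m * sqnorm (x u)).
  have [d fd] : exists d, hasder 0 f d.
    have h i : hasder (0 : R) (fun u => x u 0 i) (y t 0 i).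
      apply: (der_ext (f := fun u => y s 0 i + u * y t 0 i)) => [u|].
        by rewrite /x !mxE.
      by der_ring.
    have h0 := h 0; have h1 := h 1; have h2 := h 2.
    by eexists; rewrite /f /sqcross /sqnorm; der.
  have : f 0 < 0.
    rewrite /f /x scale0r addr0 (_ : sqcross _ _ = 0); last first.
      by rewrite /sqcross; ring.
    by rewrite add0r oppr_lt0 mulr_gt0 // sqnorm_gt0 // (blift_neq0 L).
  move=> /(cvgr_lt _ (der_continuous fd)) /nbhs_ballP[r /= r0 rP].
  exists (r / 2); first by lra.
  have : f (r / 2) < 0.
    by apply: rP; rewrite /ball /= sub0r normrN gtr0_norm; lra.
  by rewrite /f subr_lt0.
have Kx : K (x u) by apply: (KD); [|apply: (KZ); first exact: ltW]; exact: lift_in.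
have dx : det3 (x u) (y1 s) (y s) = 0.
  rewrite (_ : det3 _ _ _ = u * det3 (y t) (y1 s) (y s)).
    by rewrite g0 mulr0.
  by rewrite !det3E !mxE; ring.
have bx : bd K (x u) by split => //; exact: support_zero_not_interior dx.
have xn0 : x u != 0.
  apply/eqP => x0; have /eqP[] := blift_neq0 L s; apply: Kpt; first exact: lift_in.
  have -> : - y s = u *: y t by rewrite -[LHS]addr0 -x0 addKr.
  by apply: KZ; [exact: ltW|exact: lift_in].
have [r rs sr] := lift_surj_from (s - pi) bx xn0.
have re : `|r - s| < e'.
  by apply: (mP (x u)) => //; move: rs; lra.
(* The form vanishes at [y r] but is at least [(r - s) ^+ 2 / 4]. Then [x u] lies on the ray of
   [y s], so [y t] is parallel to [y s]. *)
have rE : r = s.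
  have [l [l0 xE]] := sr.
  have : det3 (y r) (y1 s) (y s) = 0.
    by apply: (mulfI (lt0r_neq0 l0)); rewrite mulr0 -det3Zl -xE.
  have [|] := eP r; first by rewrite (lt_le_trans re) // ge_min lexx.
  move=> + _ d0; rewrite d0 => h.
  have : (r - s) ^+ 2 = 0 by apply/eqP; rewrite eq_le sqr_ge0 andbT; lra.
  by move=> /eqP; rewrite sqrf_eq0 subr_eq0 => /eqP.
have [l [l0 xE]] := sr; rewrite rE in xE.
have ytE : y t = ((l - 1) / u) *: y s.
  have : u *: y t = (l - 1) *: y s by rewrite scalerBl scale1r -xE /x addrC addKr.
  move=> /(congr1 (fun z => u^-1 *: z)).
  by rewrite !scalerA mulVf ?gt_eqF // scale1r mulrC.
apply: (lift_not_same_ray ts).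
exact: (parallel_same_ray (blift_cone L) (lift_in _) (lift_in _)
  (blift_neq0 L _) (blift_neq0 L _) ytE).
Qed.

End StrictConvexity.

(** * Sturm comparison for an adjoint pair *)

Section Sturm.
Context {R : realType}.

Lemma der_zero_on (f : R -> R) (p q t d : R) : (forall u, p < u < q -> f u = 0) ->
  hasder t f d -> p < t < q -> d = 0.
Proof.
move=> f0 fd ptq; apply: (der_unique fd).
apply: (der_near (f := fun=> 0)); last exact: derC.
have : t \in `]p, q[%R by rewrite in_itv.
move=> /near_in_itvoo; apply: filterS => u; rewrite in_itv => /f0 //.
Qed.

Lemma norm_sin_le (x : R) : `|sin x| <= `|x|.
Proof.
wlog x0 : x / 0 < x => [H|].
  case: (ltgtP x 0) => [x0|/H//|->]; last by rewrite sin0.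
  by rewrite -normrN -sinN -[in leRHS]normrN; apply: H; rewrite oppr_gt0.
have [c _] := mean_value x0 (fun t _ => is_derive_sin t).
by rewrite sin0 !subr0 => ->; rewrite normrM ler_piMl // cos_max.
Qed.

Section AdjointPair.
Variables (a s : R) (b g g1 g2 h h1 h2 : R -> R).
Hypothesis g0d : forall t, hasder t g (g1 t).
Hypothesis g1d : forall t, hasder t g1 (g2 t).
Hypothesis g2d : forall t, hasder t g2 (- (2 * a) * g1 t - b t * g t).
Hypothesis h0d : forall t, hasder t h (h1 t).
Hypothesis h1d : forall t, hasder t h1 (h2 t).
Hypothesis h2d : forall t, hasder t h2 (- (2 * a) * h1 t + b t * h t).
Hypothesis gs : [/\ g s = 0, g1 s = 0 & g2 s = 1].
Hypothesis hs : [/\ h s = 0, h1 s = 0 & h2 s = 1].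
Hypothesis gp : forall t, g (t + 2 * pi) = g t /\ g1 (t + 2 * pi) = g1 t.
Hypothesis hp : forall t, h (t + 2 * pi) = h t /\ h1 (t + 2 * pi) = h1 t.
Hypothesis gh_gt0 : forall t, s < t < s + 2 * pi -> 0 < g t /\ 0 < h t.

(** Its derivative vanishes because the two equations are adjoint, and its value at [s] vanishes
    because of the double zeros. *)
Lemma concomitant_eq0 t :
  g2 t * h t - g1 t * h1 t + g t * h2 t + 2 * a * (g t * h t) = 0.
Proof.
pose N t := g2 t * h t - g1 t * h1 t + g t * h2 t + 2 * a * (g t * h t).
have -> : 0 = N s by rewrite /N; case: gs hs => -> -> _ [-> -> _]; ring.
apply: (der0_cst (f := N)) => u; rewrite /N.
have := g0d u; have := g1d u; have := g2d u.
have := h0d u; have := h1d u; have := h2d u => *.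
by der_ring.
Qed.

(* [Q] is the difference [f'/f - cot ((t - s) / 2) / 2] of the two Riccati
   variables, times [4 sin^2 ((t - s) / 2)], which makes it vanish at both ends
   of the interval while keeping it decreasing. *)
Let A t := g1 t / g t.
Let B t := h1 t / h t.
Let S t := sin ((t - s) / 2).
Let C t := cos ((t - s) / 2).
Let Q t := (A t + B t) * S t ^+ 2 - 2 * (S t * C t).

(** The derivative of [Q] once the concomitant has eliminated the second derivatives; every term is
    nonpositive when [a >= 1/2]. *)
Let dQ t := - (((A t + B t) * S t / 2 - C t) ^+ 2)
  - (2 * a - 1) * S t ^+ 2 - 3 / 4 * ((A t - B t) ^+ 2 * S t ^+ 2).

Let Sgt0 t : s < t < s + 2 * pi -> 0 < S t.
Proof. by move=> st; apply: sin_gt0_pi; lra. Qed.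

Let Qd t : s < t < s + 2 * pi -> hasder t Q (dQ t).
Proof.
move=> /gh_gt0[gt0 ht0].
have gn0 := lt0r_neq0 gt0; have hn0 := lt0r_neq0 ht0.
have := g0d t; have := g1d t; have := h0d t; have := h1d t => h1t h0t g1t g0t.
have At : hasder t A (g2 t / g t - A t ^+ 2).
  apply: der_eq (derM g1t (derV gn0 g0t)) _.
  by rewrite /A; field.
have Bt : hasder t B (h2 t / h t - B t ^+ 2).
  apply: der_eq (derM h1t (derV hn0 h0t)) _.
  by rewrite /B; field.
(* The concomitant divided by [g h] is a Riccati equation for [A + B]. *)
have ABt : g2 t / g t - A t ^+ 2 + (h2 t / h t - B t ^+ 2)
    = A t * B t - 2 * a - A t ^+ 2 - B t ^+ 2.
  have := concomitant_eq0 t => /(congr1 (fun z => z / (g t * h t))).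
  rewrite mul0r => c0; apply/eqP; rewrite -subr_eq0; apply/eqP.
  rewrite -[RHS]c0 /A /B; field; by rewrite ?gn0 ?hn0.
have St : hasder t S (C t / 2).
  by apply: der_eq; [rewrite /S; der|rewrite /= /C; field].
have Ct : hasder t C (- S t / 2).
  by apply: der_eq; [rewrite /C; der|rewrite /= /S; field].
apply: der_eq; first by rewrite /Q; der.
have := ABt; set A' := _ - A t ^+ 2; set B' := _ - B t ^+ 2 => e.
have e' : B' = A t * B t - 2 * a - A t ^+ 2 - B t ^+ 2 - A' by rewrite -e; ring.
rewrite /dQ e' /=.
by field.
Qed.

Let Q_small : exists2 e, 0 < e & forall r, 0 < `|r| < e ->
  `|Q (s + r)| <= 5 * `|r|.
Proof.
have g2s : hasder s g1 1 by have := g1d s; case: gs => _ _ ->.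
have h2s : hasder s h1 1 by have := h1d s; case: hs => _ _ ->.
case: gs hs => gs0 gs1 _ [hs0 hs1 _].
have [e e0 eP] := double_zero_bounds g0d g2s gs0 gs1.
have [e' e'0 e'P] := double_zero_bounds h0d h2s hs0 hs1.
(* A quotient such as [A] is at most of order [1 / r], and the squared sine is of order [r ^+ 2].
   The two products contribute [2 |r|] each and the last term of [Q] contributes [|r|]. *)
have aux (x x1 z r : R) : 0 < `|r| -> r ^+ 2 / 4 <= x -> `|x1| <= 2 * `|r| ->
    `|z| <= `|r| / 2 -> `|x1 / x * z ^+ 2| <= 2 * `|r|.
  move=> r0; rewrite -(real_normK (num_real r)); set rho := `|r| in r0 *.
  move=> xr x1r zr.
  have r2 : 0 < rho ^+ 2 by rewrite exprn_gt0.
  have x0 : 0 < x by lra.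
  rewrite (normrM (x1 / x)) (normrM x1) normfV (gtr0_norm x0) normrX mulrAC ler_pdivrMr //.
  have z2 : `|z| ^+ 2 <= rho ^+ 2 / 4.
    by have := @lerXn2r R 2 `|z| (rho / 2); rewrite !nnegrE normr_ge0 expr_div_n; lra.
  have := @ler_pM R _ _ _ _ (normr_ge0 x1) (sqr_ge0 `|z|) x1r z2.
  move=> /le_trans; apply; rewrite ler_pM2l; lra.
exists (Num.min e e'); first by rewrite lt_min e0.
move=> r /andP[r0]; rewrite lt_min => /andP[re re'].
have sr : s + r - s = r by rewrite addrC addKr.
have := eP (s + r); have := e'P (s + r); rewrite sr => /(_ re')[hx hx1] /(_ re)[gx gx1].
have Sr : `|S (s + r)| <= `|r| / 2.
  rewrite /S sr; have := norm_sin_le (r / 2).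
  by rewrite normrM [`|2^-1|]gtr0_norm ?invr_gt0.
have := aux _ _ _ _ r0 hx hx1 Sr; have := aux _ _ _ _ r0 gx gx1 Sr.
have : `|2 * (S (s + r) * C (s + r))| <= `|r|.
  rewrite !normrM (gtr0_norm (x := 2)); last lra.
  have := cos_max ((s + r - s) / 2); rewrite -/(C _) => Cr.
  have := @ler_pM R _ _ _ _ (normr_ge0 _) (normr_ge0 _) Sr Cr; lra.
rewrite /Q /A /B !ler_norml; lra.
Qed.

(** Both [S] and [C] change sign over a period, and [Q] is quadratic in them. *)
Let Q_periodic t : Q (t + 2 * pi) = Q t.
Proof.
rewrite /Q /A /B; case: (gp t) (hp t) => -> -> [-> ->].
have e : (t + 2 * pi - s) / 2 = (t - s) / 2 + pi by lra.
by rewrite /S /C e sinDpi cosDpi; ring.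
Qed.

Hypothesis a_ge : 2^-1 <= a.

Let dQ_le0 t : dQ t <= 0.
Proof.
have := sqr_ge0 ((A t + B t) * S t / 2 - C t).
have : 0 <= (2 * a - 1) * S t ^+ 2.
  by apply: mulr_ge0; [move: a_ge; lra|exact: sqr_ge0].
have : 0 <= (A t - B t) ^+ 2 * S t ^+ 2 by rewrite mulr_ge0 ?sqr_ge0.
by rewrite /dQ; lra.
Qed.

Let Q_le t u : s < t -> t < u -> u < s + 2 * pi -> Q u <= Q t.
Proof.
move=> st tu us.
have [|c _ e] := @mean_value _ Q dQ t u tu.
  by move=> x xtu; apply: Qd; lra.
rewrite -subr_le0 e mulr_le0_ge0 //; lra.
Qed.

(** [Q] is nonincreasing on the interval and tends to 0 at both ends, the right end being handled by
    periodicity. *)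
Let Q_eq0 t : s < t < s + 2 * pi -> Q t = 0.
Proof.
move=> /andP[st ts]; have [e e0 eP] := Q_small.
have bound d : 0 < d -> d < e -> d < t - s -> d < s + 2 * pi - t -> `|Q t| <= 5 * d.
  move=> d0 de d1 d2.
  have := eP d; have := eP (- d); rewrite normrN (gtr0_norm d0) d0 => /(_ de) hm /(_ de) hp'.
  have : Q t <= Q (s + d) by apply: Q_le; lra.
  have : Q (s - d + 2 * pi) <= Q t by apply: Q_le; lra.
  by rewrite Q_periodic; move: hm hp'; rewrite !ler_norml; lra.
apply/eqP; rewrite -normr_eq0 eq_le normr_ge0 andbT; apply/ler_addgt0Pr => eps eps0.
rewrite add0r.
(* Makes [5 * d <= eps], keeps [d] in the range of [Q_small], and places [t] between [s + d] and
   [s + 2 * pi - d]. *)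
pose d := Num.min (Num.min (e / 2) (eps / 5)) (Num.min ((t - s) / 2) ((s + 2 * pi - t) / 2)).
have d0 : 0 < d by rewrite !lt_min; apply/andP; split; apply/andP; split; lra.
have : d <= d by [].
rewrite {2}/d !le_min => /andP[/andP[d1 d2] /andP[d3 d4]].
by have := bound d d0; lra.
Qed.

(** As [Q] is identically 0, each term of [dQ] vanishes, so [a = 1/2] and [A = B]. *)
Lemma sturm_adjoint_pair t : s < t < s + 2 * pi -> a = 2^-1 /\ b t = 0.
Proof.
move=> st.
have sq u : s < u < s + 2 * pi -> a = 2^-1 /\ g1 u * h u - g u * h1 u = 0.
  move=> su.
  have := der_zero_on Q_eq0 (Qd su) su; rewrite /dQ.
  have S0 := Sgt0 su; have [g0 h0] := gh_gt0 su.
  have := sqr_ge0 ((A u + B u) * S u / 2 - C u).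
  have : 0 <= (2 * a - 1) * S u ^+ 2.
    by apply: mulr_ge0; [move: a_ge; lra|exact: sqr_ge0].
  have : 0 <= (A u - B u) ^+ 2 * S u ^+ 2 by rewrite mulr_ge0 ?sqr_ge0.
  move=> p1 p2 p3 e.
  have /eqP : (2 * a - 1) * S u ^+ 2 = 0 by lra.
  have /eqP : (A u - B u) ^+ 2 * S u ^+ 2 = 0 by lra.
  rewrite mulf_eq0 !sqrf_eq0 (gt_eqF S0) orbF => /eqP AB.
  rewrite mulf_eq0 sqrf_eq0 (gt_eqF S0) orbF => /eqP a2.
  split; first by lra.
  have -> : g1 u * h u - g u * h1 u = (A u - B u) * (g u * h u).
    by rewrite /A /B; field; rewrite !gt_eqF.
  by rewrite AB mul0r.
split; first by have [] := sq t st.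
(* The Wronskian of [g] and [h] vanishes on an interval; differentiating it twice leaves
   [2 b g h = 0], since [(g, g1, g2)] and [(h, h1, h2)] are proportional. *)
have w1 u : s < u < s + 2 * pi -> g1 u * h u - g u * h1 u = 0 by move=> /sq[].
have w2 u : s < u < s + 2 * pi -> g2 u * h u - g u * h2 u = 0.
  move=> su; apply: (der_zero_on w1 _ su).
  have := g0d u; have := g1d u; have := h0d u; have := h1d u => *.
  by der_ring.
have w3 : g2 t * h1 t - g1 t * h2 t - 2 * b t * (g t * h t)
    - 2 * a * (g1 t * h t - g t * h1 t) = 0.
  apply: (der_zero_on w2 _ st).
  have := g0d t; have := g1d t; have := g2d t.
  have := h0d t; have := h1d t; have := h2d t => *.
  by der_ring.
have [g0 h0] := gh_gt0 st.
have e1 := w1 t st; have e2 := w2 t st; rewrite e1 mulr0 subr0 in w3.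
have e3 : g2 t * h1 t - g1 t * h2 t = 0.
  apply: (mulfI (lt0r_neq0 (mulr_gt0 g0 h0))); rewrite mulr0.
  have -> : g t * h t * (g2 t * h1 t - g1 t * h2 t) =
    g t * h1 t * (g2 t * h t - g t * h2 t) - g t * h2 t * (g1 t * h t - g t * h1 t).
    ring.
  by rewrite e1 e2 !mulr0 subr0.
have /eqP : b t * (g t * h t) = 0 by lra.
by rewrite mulf_eq0 (gt_eqF (mulr_gt0 g0 h0)) orbF => /eqP.
Qed.

End AdjointPair.
End Sturm.

(** * The harmonic oscillator and polar coordinates *)

Section Harmonic.
Context {R : realType}.

(** The coordinates [p] and [q] of [(w f, f')] in a frame rotating with speed [w] are constant. *)
Lemma harmonic_solution (w : R) (f f1 : R -> R) :
  (forall t, hasder t f (f1 t)) -> (forall t, hasder t f1 (- w ^+ 2 * f t)) ->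
  forall t, w * f t = w * f 0 * cos (w * t) + f1 0 * sin (w * t) /\
    f1 t = - (w * f 0) * sin (w * t) + f1 0 * cos (w * t).
Proof.
move=> fd f1d.
pose p t := w * f t * cos (w * t) - f1 t * sin (w * t).
pose q t := w * f t * sin (w * t) + f1 t * cos (w * t).
have pE t : p t = w * f 0.
  rewrite (@der0_cst _ p _ t 0) => [|u].
    by rewrite /p mulr0 cos0 sin0; ring.
  rewrite /p; have := fd u; have := f1d u => *.
  by der_ring.
have qE t : q t = f1 0.
  rewrite (@der0_cst _ q _ t 0) => [|u].
    by rewrite /q mulr0 cos0 sin0; ring.
  rewrite /q; have := fd u; have := f1d u => *.
  by der_ring.
move=> t; rewrite -(pE t) -(qE t) /p /q; have := cos2Dsin2 (w * t).
set c := cos _; set s := sin _ => cs.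
by split; [rewrite -[LHS]mulr1 -cs|rewrite -[LHS]mulr1 -cs]; ring.
Qed.

Lemma polar_coordinates (x1 x2 : R) : exists th,
  x1 = Num.sqrt (x1 ^+ 2 + x2 ^+ 2) * cos th /\
  x2 = Num.sqrt (x1 ^+ 2 + x2 ^+ 2) * sin th.
Proof.
set r := Num.sqrt _.
have r0 : 0 <= r by exact: sqrtr_ge0.
have h1 := sqr_ge0 x1; have h2 := sqr_ge0 x2.
have rE : r ^+ 2 = x1 ^+ 2 + x2 ^+ 2 by rewrite sqr_sqrtr // addr_ge0.
have [re|rn0] := eqVneq r 0.
  exists 0; rewrite re !mul0r.
  rewrite re expr0n /= in rE.
  by split; apply/eqP; rewrite -sqrf_eq0; apply/eqP; lra.
have rp : 0 < r by rewrite lt_neqAle eq_sym rn0.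
have x1E : x1 = r * (x1 / r) by rewrite mulrC divfK.
have cr : -1 <= x1 / r <= 1.
  rewrite ler_pdivlMr // ler_pdivrMr // mulN1r mul1r -ler_norml.
  by rewrite -(@ler_sqr _ `|x1| r) ?nnegrE // real_normK ?num_real //; lra.
have acE : cos (acos (x1 / r)) = x1 / r by apply: acosK; rewrite in_itv.
have asE : r * sin (acos (x1 / r)) = `|x2|.
  have sn : 0 <= sin (acos (x1 / r)).
    by apply: sin_ge0_pi; rewrite acos_ge0 ?acos_lepi.
  apply/eqP; rewrite -(@eqrXn2 _ 2) ?mulr_ge0 //; apply/eqP.
  rewrite real_normK ?num_real // exprMn sin2cos2 acE mulrBr mulr1 -exprMn -x1E rE.
  by lra.
have [x20|x20] := leP 0 x2.
  by exists (acos (x1 / r)); rewrite acE -x1E asE ger0_norm.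
by exists (- acos (x1 / r)); rewrite cosN sinN acE -x1E mulrN asE ltr0_norm ?opprK.
Qed.

End Harmonic.

(** * Cones with [a >= 1/2] are ellipsoidal *)

Section Ellipsoidal.
Context {R : realType}.
Notation V := 'rV[R]_3.
Variables (K : set V) (y y1 y2 : R -> V) (a : R) (b : R -> R).
Hypothesis L : balanced_lift K y y1 y2 a b.

Lemma vder_periodic (f f1 : R -> V) : (forall t, f (t + 2 * pi) = f t) ->
  (forall t, vder f t (f1 t)) -> forall t, f1 (t + 2 * pi) = f1 t.
Proof.
move=> fp fd t; apply: (vder_unique (f := f) (t := t)) => //.
apply: (vder_ext (f := fun u => f (2 * pi + u))).
  by move=> u; rewrite addrC.
by apply: vder_addl; rewrite addrC.
Qed.

Lemma blift1_periodic t : y1 (t + 2 * pi) = y1 t.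
Proof. exact: (vder_periodic (blift_periodic L) (blift_d0 L)). Qed.

Lemma blift2_periodic t : y2 (t + 2 * pi) = y2 t.
Proof. exact: (vder_periodic blift1_periodic (blift_d1 L)). Qed.

(** Sturm comparison on an interval of length [2 pi] centred at [t], whence [s = t - pi]. *)
Lemma blift_ge_half t : 2^-1 <= a -> a = 2^-1 /\ b t = 0.
Proof.
move=> a_ge; pose s := t - pi; have pi0 := pi_gt0 R.
have c x u := @vderC R x u.
apply: (@sturm_adjoint_pair _ a s b
  (fun t => det3 (y t) (y1 s) (y s)) (fun t => det3 (y1 t) (y1 s) (y s))
  (fun t => det3 (y2 t) (y1 s) (y s))
  (fun t => det3 (y s) (y1 t) (y t)) (fun t => det3 (y s) (y2 t) (y t))
  (fun t => - (2 * a) * det3 (y s) (y1 t) (y t) + det3 (y s) (y2 t) (y1 t))) => //.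
- move=> u; apply: der_eq (der_det3 (blift_d0 L u) (c _ _) (c _ _)) _.
  by rewrite !det3E !mxE; ring.
- move=> u; apply: der_eq (der_det3 (blift_d1 L u) (c _ _) (c _ _)) _.
  by rewrite !det3E !mxE; ring.
- move=> u; apply: der_eq (der_det3 (blift_d2 L u) (c _ _) (c _ _)) _.
  by rewrite !det3E !mxE; ring.
- move=> u; apply: der_eq (der_det3 (c _ _) (blift_d1 L u) (blift_d0 L u)) _.
  by rewrite !det3E !mxE; ring.
- move=> u; apply: der_eq (der_det3 (c _ _) (blift_d2 L u) (blift_d0 L u)) _.
  by rewrite !det3E !mxE; ring.
- move=> u.
  have h1 := der_det3 (c (y s) u) (blift_d1 L u) (blift_d0 L u).
  have h2 := der_det3 (c (y s) u) (blift_d2 L u) (blift_d1 L u).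
  apply: der_eq (derD (derM (derC (- (2 * a)) u) h1) h2) _.
  by rewrite !det3E !mxE; ring.
- by split; rewrite ?(blift_det L) // !det3E; ring.
- split; try by rewrite !det3E; ring.
  by rewrite -(blift_det L s) !det3E; ring.
- by move=> u; rewrite (blift_periodic L) blift1_periodic.
- by move=> u; rewrite (blift_periodic L) blift1_periodic blift2_periodic.
(* The second function is the supporting form at [y u] evaluated at [y s], which equals
   [y (s + 2 * pi)]. *)
- move=> u su; split; first by apply: (support_gt0 L); lra.
  by rewrite -(blift_periodic L s); apply: (support_gt0 L); lra.
- by rewrite /s; lra.
Qed.

(** The equation becomes [y''' = - y'], so [y t = c - y2 t] with [y2] a combination of [cos t] and
    [sin t]: the curve is a conic. *)
Lemma blift_ellipsoidal : 2^-1 <= a -> ellipsoidal K.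
Proof.
move=> a_ge.
have y2d t : vder y2 t (- y1 t).
  have [ae be] := blift_ge_half t a_ge; have := blift_d2 L t.
  by rewrite ae be scale0r subr0 mulfV ?scaleN1r.
pose c := y 0 + y2 0.
have yc t : y t = c - y2 t.
  apply/rowP => i; rewrite !mxE.
  suff e : y t 0 i + y2 t 0 i = y 0 0 i + y2 0 0 i by rewrite -e addrK.
  apply: (@der0_cst _ (fun t => y t 0 i + y2 t 0 i)) => u.
  have := blift_d0 L u i; have := y2d u i; rewrite mxE => *.
  by der_ring.
have sol t i : y2 t 0 i = y2 0 0 i * cos t - y1 0 0 i * sin t /\
               y1 t 0 i = y2 0 0 i * sin t + y1 0 0 i * cos t.
  have [u|u|] := @harmonic_solution _ 1 (fun t => - y2 t 0 i) (fun t => y1 t 0 i) _ _ t.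
  - by have := y2d u i; rewrite mxE => *; der_ring.
  - by have := blift_d1 L u i => *; der_ring.
  - by rewrite !mul1r => h1 h2; split; lra.
have det1 : det3 (y2 0) (y1 0) c = 1.
  by rewrite -(blift_det L 0) yc !det3E !mxE; ring.
(* [M] maps the boundary vector [(1, cos t, sin t)] of the Lorentz cone to [y t]. *)
pose M : 'M[R]_3 := \matrix_(i, j) (if i == 0 :> nat then c 0 j
  else if i == 1 :> nat then (- y2 0) 0 j else y1 0 0 j).
have ME (x : V) : x *m M = x 0 0 *: c - x 0 1 *: y2 0 + x 0 2 *: y1 0.
  apply/rowP => j; rewrite !mxE !big_ord_recl big_ord0 !mxE /= addr0.
  have -> : lift (ord0 : 'I_3) (ord0 : 'I_2) = 1 by apply/val_inj.
  have -> : lift (ord0 : 'I_3) (lift (ord0 : 'I_2) (ord0 : 'I_1)) = 2 by apply/val_inj.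
  have -> : ord0 = 0 :> 'I_3 by apply/val_inj.
  by rewrite mulrN addrA.
have Mu : M \in unitmx.
  rewrite unitmxE (_ : \det M = det3 c (- y2 0) (y1 0)); last by [].
  rewrite (_ : det3 _ _ _ = - det3 (y2 0) (y1 0) c); last by rewrite !det3E !mxE; ring.
  by rewrite det1 unitrN1.
have [_ KD KZ _ _] := blift_cone L.
exists M; split => //; apply/seteqP; split => [x Kx|_ [x xL <-]].
- exists (x *m invmx M); last by rewrite mulmxKV.
  set z := x *m invmx M; have xE : x = z *m M by rewrite mulmxKV.
  (* At the angle [th] of the last two coordinates, the supporting form is exactly the defining
     inequality of the Lorentz cone. *)
  have [th [z1 z2]] := polar_coordinates (z 0 1) (z 0 2).
  rewrite /lorentz_cone /=.
  have := support_ge0 L th Kx.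
  have -> : det3 x (y1 th) (y th) =
      (z 0 0 - z 0 1 * cos th - z 0 2 * sin th) * det3 (y2 0) (y1 0) c.
    have [a1 b1] := sol th 0; have [a2 b2] := sol th 1; have [a3 b3] := sol th 2.
    rewrite xE ME yc !det3E !mxE a1 a2 a3 b1 b2 b3.
    have := cos2Dsin2 th; rewrite addrC => /(canRL (addrK _)) s2.
    ring: s2.
  rewrite det1 mulr1 => h.
  have : z 0 1 * cos th + z 0 2 * sin th = Num.sqrt (z 0 1 ^+ 2 + z 0 2 ^+ 2).
    move: z1 z2; set r := Num.sqrt _ => -> ->.
    by rewrite -[RHS]mulr1 -(cos2Dsin2 th); ring.
  by move: h; lra.
- rewrite /lorentz_cone /= in xL.
  have [th [x1 x2]] := polar_coordinates (x 0 1) (x 0 2).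
  set r := Num.sqrt _ in xL x1 x2.
  have r0 : 0 <= r by exact: sqrtr_ge0.
  (* A vector of the Lorentz cone is a nonnegative combination of the two boundary rays at the
     opposite angles [th] and [th + pi]. *)
  have -> : x *m M = ((x 0 0 + r) / 2) *: y th + ((x 0 0 - r) / 2) *: y (th + pi).
    rewrite ME; apply/rowP => i; rewrite !yc !mxE.
    have [-> _] := sol th i; have [-> _] := sol (th + pi) i.
    by rewrite cosDpi sinDpi x1 x2; field.
  by apply: (KD); apply: (KZ); try exact: (lift_in L); lra.
Qed.

End Ellipsoidal.

(** * Implicit differentiation and periodic solutions *)

Section ScalarLemmas.
Context {R : realType}.

(** The relation [M (s t) = N t] with [k != 0] gives [s] the derivative [n / k], though only
    continuity of [s] at [t0] is assumed; the Caratheodory slopes are divided and multiplied. *)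
Lemma der_implicit_comp (M N s h : R -> R) (t0 k n d : R) :
  hasder (s t0) M k -> k != 0 -> hasder t0 N n -> hasder (s t0) h d ->
  {for t0, continuous s} -> (forall t, M (s t) = N t) ->
  hasder t0 (fun t => h (s t)) (n / k * d).
Proof.
move=> /is_derive1_caratheodory[G [GE cG Gk]] k0.
move=> /is_derive1_caratheodory[H [HE cH Hn]].
move=> /is_derive1_caratheodory[W [WE cW Wd]] cs MN.
pose F t := H t / G (s t) * W (s t).
have cGs : {for t0, continuous (G \o s)} by exact: continuous_comp.
have cWs : {for t0, continuous (W \o s)} by exact: continuous_comp.
have Gs0 : (G \o s) t0 != 0 by rewrite /= Gk.
have cF : {for t0, continuous F}.
  exact: (cvgM (cvgM cH (cvgV Gs0 cGs)) cWs).
have G0 : \forall t \near t0, G (s t) != 0 by exact: (cvgr_neq0 _ cGs Gs0).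
(* Away from [t0] the slope [G (s t)] may vanish; the plain difference quotient is used there and
   does not affect the limit. *)
pose F' t := if G (s t) == 0 then (h (s t) - h (s t0)) / (t - t0) else F t.
apply/is_derive1_caratheodory; exists F'; split.
- move=> t; rewrite /F'; case: eqP => [Gt|/eqP Gt].
    have tn : t != t0 by apply/eqP => te; move: Gs0; rewrite /= -te Gt eqxx.
    by rewrite divfK // subr_eq0.
  have e : s t - s t0 = H t * (t - t0) / G (s t).
    by rewrite -HE -!MN GE [G _ * _]mulrC mulfK.
  by rewrite WE e /F; field.
- have F'E : F' t0 = F t0 by rewrite /F' (negbTE Gs0).
  rewrite /prop_for /continuous_at F'E; apply: cvg_trans cF; apply: near_eq_cvg.
  by apply: filterS G0 => t Gt; rewrite /F' (negbTE Gt).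
- by rewrite /F' (negbTE Gs0) /F Hn Gk Wd.
Qed.

Lemma periodic_monotone_cst (p dp : R -> R) : (forall t, hasder t p (dp t)) ->
  (forall t, 0 <= dp t) -> (forall t, p (t + 2 * pi) = p t) -> forall t, dp t = 0.
Proof.
move=> pd dp0 pp.
have mono t u : t <= u -> p t <= p u.
  rewrite le_eqVlt => /predU1P[->//|tu].
  have [c _ e] := mean_value tu (fun x _ => pd x).
  by rewrite -subr_ge0 e mulr_ge0 //; lra.
have cst t u : t <= u -> p t = p u.
  move=> tu; apply/eqP; rewrite eq_le mono //=.
  have [n /andP[n0 _]] := reduce_mod_2pi u t.
  by rewrite -(periodic_int pp n t) mono.
move=> t; apply: (der_unique (pd t)).
apply: (der_ext (f := fun=> p 0)); last exact: derC.
by move=> u; have [|/ltW] := leP 0 u => /cst.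
Qed.

(** For [a <= 0], [x x'] is periodic with nonnegative derivative, so [x] is constant, and being the
    derivative of the periodic [W] it is 0. For [0 < a < 1/2] the frequency is strictly between 0
    and 1, which excludes period [2 pi]. *)
Lemma periodic_oscillator_cst (a : R) (W x x1 : R -> R) : a < 2^-1 ->
  (forall t, hasder t W (x t)) -> (forall t, hasder t x (x1 t)) ->
  (forall t, hasder t x1 (- (2 * a) * x t)) ->
  (forall t, W (t + 2 * pi) = W t) -> (forall t, x (t + 2 * pi) = x t) ->
  (forall t, x1 (t + 2 * pi) = x1 t) -> forall t, x t = 0.
Proof.
move=> a_lt Wd xd x1d Wp xp x1p.
have pi0 := pi_gt0 R.
have [a0|a0] := leP a 0.
  have x10 t : x1 t = 0.
    have : x1 t ^+ 2 - 2 * a * x t ^+ 2 = 0.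
      apply: (@periodic_monotone_cst (fun t => x t * x1 t)
        (fun t => x1 t ^+ 2 - 2 * a * x t ^+ 2)) => [u|u|u].
      - by have := xd u; have := x1d u => *; der_ring.
      - have := sqr_ge0 (x1 u); have : 0 <= - a * x u ^+ 2.
          by rewrite mulr_ge0 ?sqr_ge0 ?oppr_ge0.
        lra.
      - by rewrite xp x1p.
    have : 0 <= - a * x t ^+ 2 by rewrite mulr_ge0 ?sqr_ge0 ?oppr_ge0.
    have := sqr_ge0 (x1 t) => h1 h2 h3.
    by apply/eqP; rewrite -sqrf_eq0; apply/eqP; lra.
  have xc t : x t = x 0.
    by apply: der0_cst => u; have := xd u; rewrite x10.
  have two_pi : 0 < 2 * pi :> R by lra.
  have [c _] := mean_value two_pi (fun u _ => Wd u).
  rewrite -[2 * pi]add0r Wp subrr => /esym/eqP.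
  rewrite mulf_eq0 add0r subr0 (gt_eqF two_pi) orbF => /eqP xc0 t.
  by rewrite xc -(xc c).
pose w := Num.sqrt (2 * a).
have w2 : w ^+ 2 = 2 * a by rewrite sqr_sqrtr; lra.
have w0 : 0 < w by rewrite sqrtr_gt0; lra.
have w1 : w < 1.
  by rewrite -(@ltr_pXn2r _ 2) ?nnegrE ?(ltW w0) // w2 expr1n; lra.
have sol t := @harmonic_solution _ w x x1 xd
  (fun t => eq_ind_r (fun c => hasder t x1 (- c * x t)) (x1d t) w2) t.
set th := w * (2 * pi).
(* This is the determinant of the identity minus the rotation by [th]. If it vanished, the frequency
   [w] would be an integer. *)
have thn : 0 < 2 - 2 * cos th.
  suff : cos th != 1 by have := cos_le1 th; rewrite le_eqVlt => /predU1P[->/eqP//|]; lra.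
  apply/eqP => /cos_eq1[n]; rewrite /th => /(mulIf _) wn.
  have {wn} wn : w = n%:~R by apply: wn; rewrite gt_eqF //; lra.
  move: w0 w1; rewrite wn ltr0z (_ : 1 = 1%:~R :> R) // ltr_int; lia.
have x2pi : x (2 * pi) = x 0 by rewrite -[2 * pi]add0r xp.
have x12pi : x1 (2 * pi) = x1 0 by rewrite -[2 * pi]add0r x1p.
have [] := sol (2 * pi); rewrite x2pi x12pi -/th.
set c := cos th; set s := sin th; set X := w * x 0; set Y := x1 0 => e1 e2.
have cs : c ^+ 2 + s ^+ 2 = 1 by exact: cos2Dsin2.
have X0 : X = 0.
  apply: (mulfI (lt0r_neq0 thn)); rewrite mulr0.
  have -> : (2 - 2 * cos th) * X = (X - (X * c + Y * s)) * (1 - c)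
      + (Y - (- X * s + Y * c)) * s + X * (1 - (c ^+ 2 + s ^+ 2)).
    by rewrite -/c; ring.
  by rewrite -e1 -e2 cs !subrr !mul0r mulr0 !addr0.
have Y0 : Y = 0.
  apply: (mulfI (lt0r_neq0 thn)); rewrite mulr0.
  have -> : (2 - 2 * cos th) * Y = (Y - (- X * s + Y * c)) * (1 - c)
      - (X - (X * c + Y * s)) * s + Y * (1 - (c ^+ 2 + s ^+ 2)).
    by rewrite -/c; ring.
  by rewrite -e1 -e2 cs !subrr !mul0r mulr0 subrr addr0.
move=> t; apply: (mulfI (lt0r_neq0 w0)); rewrite mulr0.
by have [-> _] := sol t; rewrite -/X -/Y X0 Y0 !mul0r addr0.
Qed.

End ScalarLemmas.

(** * Comparison of two balanced lifts *)

Section Reparametrization.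
Context {R : realType}.
Notation V := 'rV[R]_3.
Variables (K : set V) (y y1 y2 z z1 z2 : R -> V) (a a' : R) (b b' : R -> R).
Hypothesis Ly : balanced_lift K y y1 y2 a b.
Hypothesis Lz : balanced_lift K z z1 z2 a' b'.

Lemma blift_same_ray s s' : same_ray (z s) (z s') ->
  exists n : int, s' = s + n%:~R * (2 * pi).
Proof.
move=> sr; have [n /andP[n0 n1]] := reduce_mod_2pi s s'.
exists (- n); rewrite intrN mulNr; set u := s' + _ in n0 n1.
suff ue : u = s by rewrite -ue /u addrK.
have [//|un] := eqVneq u s.
have su : 0 < u - s by rewrite subr_gt0 lt_neqAle eq_sym un.
have /(lift_not_same_ray Lz) : 0 < u - s < 2 * pi by rewrite su /=; lra.
by rewrite /u (periodic_int (blift_periodic Lz)) => /(_ sr).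
Qed.

Variables (sg lam : R -> R).
Hypothesis lam_gt0 : forall t, 0 < lam t.
Hypothesis zsg : forall t, z (sg t) = lam t *: y t.

(** Expresses [lam] through the lifts, from which its differentiability and periodicity are
    deduced. *)
Lemma lamE t : lam t = det3 (y2 t) (y1 t) (z (sg t)).
Proof.
rewrite zsg -[LHS]mulr1 -(blift_det Ly t) !det3E !mxE; ring.
Qed.

(* The coordinates of [z1 (sg t)] in the frame [y2 t], [y1 t], [y t]. *)
Let kap t := det3 (y2 t) (z1 (sg t)) (y t).
Let mu t := det3 (y2 t) (y1 t) (z1 (sg t)).

(* The supporting form of [K] at [y t] is minimal along [z] at [sg t]. *)
Lemma tangent_agree t : det3 (z1 (sg t)) (y1 t) (y t) = 0.
Proof.
have c x u := @vderC R x u.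
have zd u : hasder u (fun u => det3 (z u) (y1 t) (y t)) (det3 (z1 u) (y1 t) (y t)).
  apply: der_eq (der_det3 (blift_d0 Lz u) (c _ _) (c _ _)) _.
  by rewrite !det3E !mxE; ring.
apply: (der_at_min (zd (sg t))) => [u|u]; first by exists (det3 (z1 u) (y1 t) (y t)).
rewrite zsg (_ : det3 (lam t *: y t) _ _ = 0); last by rewrite !det3E !mxE; ring.
exact: (support_ge0 Ly _ (lift_in Lz _)).
Qed.

Lemma z1E t : z1 (sg t) = kap t *: y1 t + mu t *: y t.
Proof.
have := det3_decomp (y2 t) (y1 t) (y t) (z1 (sg t)).
by rewrite (blift_det Ly) scale1r tangent_agree scale0r add0r.
Qed.

(** Otherwise [z1] and [z] would be parallel at [sg t], against the normalization of [z]. *)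
Lemma kap_neq0 t : kap t != 0.
Proof.
apply/eqP => k0; have := blift_det Lz (sg t).
rewrite z1E k0 scale0r add0r zsg.
have -> : det3 (z2 (sg t)) (mu t *: y t) (lam t *: y t) = 0.
  by rewrite !det3E !mxE; ring.
by move=> /eqP; rewrite eq_sym oner_eq0.
Qed.

(* [sg] itself may jump by multiples of [2 * pi]; only its composition with
   periodic functions is differentiable. *)
Lemma der_comp_sg (h h1 : R -> R) t : (forall u, h (u + 2 * pi) = h u) ->
  (forall u, hasder u h (h1 u)) ->
  hasder t (fun u => h (sg u)) (lam t / kap t * h1 (sg t)).
Proof.
move=> hp hd; have pi0 := pi_gt0 R.
(* [s u] is the representative of [sg u] modulo [2 pi] in the window centred at [sg t]; it is
   continuous at [t]. *)
have /choice[s sP] : forall u, exists v : R,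
    sg t - pi <= v < sg t + pi /\ exists n : int, v = sg u + n%:~R * (2 * pi).
  move=> u; have [n n0] := reduce_mod_2pi (sg t - pi) (sg u).
  by exists (sg u + n%:~R * (2 * pi)); split; [lra|exists n].
have hs u : h (s u) = h (sg u).
  by have [_ [n ->]] := sP u; exact: (periodic_int hp).
have zs u : z (s u) = lam u *: y u.
  by have [_ [n ->]] := sP u; rewrite (periodic_int (blift_periodic Lz)) zsg.
have st : s t = sg t.
  have [/andP[s0 s1] _] := sP t.
  have sr : same_ray (z (s t)) (z (sg t)) by rewrite zs zsg; exact: same_ray_refl.
  have [lt|gt|//] := ltgtP (s t) (sg t).
    by have /(lift_not_same_ray Lz)[] : 0 < sg t - s t < 2 * pi by lra.
  have /(lift_not_same_ray Lz)[] : 0 < s t - sg t < 2 * pi by lra.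
  exact: same_ray_sym.
have cs : {for t, continuous s}.
  apply/cvgrPdist_lt => e e0.
  pose e' := Num.min e pi.
  have e'0 : 0 < e' by rewrite lt_min e0.
  have e'pi : e' <= pi by rewrite ge_min lexx orbT.
  have [m m0 mP] := lift_localize Lz (sg t) e'0 e'pi.
  pose f u := sqcross (y u) (z (sg t)) + - (m * sqnorm (y u)).
  have [d fd] : exists d, hasder t f d.
    have h0 := blift_d0 Ly t 0; have h2 := blift_d0 Ly t 1; have h3 := blift_d0 Ly t 2.
    by eexists; rewrite /f /sqcross /sqnorm; der.
  have : f t < 0.
    rewrite /f zsg (_ : sqcross _ _ = 0); last by rewrite /sqcross !mxE; ring.
    by rewrite add0r oppr_lt0 mulr_gt0 // sqnorm_gt0 // (blift_neq0 Ly).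
  move=> /(cvgr_lt _ (der_continuous fd)); apply: filterS => u fu.
  rewrite st distrC; apply: (@lt_le_trans _ _ e'); last by rewrite ge_min lexx.
  apply: (mP (y u)); last by have [] := sP u.
    by rewrite zs; apply: same_ray_sym; exists (lam u).
  by move: fu; rewrite /f subr_lt0.
have c x u := @vderC R x u.
(* [E1] and [E2] are the coordinates along [y t] and [y1 t]. Their ratio is unchanged by scaling,
   hence agrees along both lifts and determines [s] implicitly. *)
pose E1 x := det3 (y2 t) (y1 t) x.
pose E2 x := det3 (y2 t) x (y t).
have E1d (f f1 : R -> V) u : vder f u (f1 u) -> hasder u (fun v => E1 (f v)) (E1 (f1 u)).
  move=> fd; apply: der_eq (der_det3 (c _ _) (c _ _) fd) _.
  by rewrite /E1 !det3E !mxE; ring.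
have E2d (f f1 : R -> V) u : vder f u (f1 u) -> hasder u (fun v => E2 (f v)) (E2 (f1 u)).
  move=> fd; apply: der_eq (der_det3 (c _ _) fd (c _ _)) _.
  by rewrite /E2 !det3E !mxE; ring.
have E1y : E1 (y t) = 1 by exact: blift_det Ly t.
have E2y : E2 (y t) = 0 by rewrite /E2 !det3E; ring.
have E2y1 : E2 (y1 t) = 1 by exact: blift_det Ly t.
have E1z : E1 (z (sg t)) = lam t by rewrite /E1 -lamE.
have E2z : E2 (z (sg t)) = 0 by rewrite zsg /E2 !det3E !mxE; ring.
have ln0 := lt0r_neq0 (lam_gt0 t).
apply: (der_ext hs).
have Md : hasder (s t) (fun u => E2 (z u) * (E1 (z u))^-1) (kap t / lam t).
  rewrite st.
  have E1n : E1 (z (sg t)) != 0 by rewrite E1z.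
  have h1' := derV E1n (E1d _ _ _ (blift_d0 Lz (sg t))).
  apply: der_eq (derM (E2d _ _ _ (blift_d0 Lz (sg t))) h1') _.
  by rewrite E2z E1z mul0r add0r mulrC.
have Nd : hasder t (fun u => E2 (y u) * (E1 (y u))^-1) 1.
  have E1n : E1 (y t) != 0 by rewrite E1y oner_neq0.
  have h1' := derV E1n (E1d _ _ _ (blift_d0 Ly t)).
  apply: der_eq (derM (E2d _ _ _ (blift_d0 Ly t)) h1') _.
  by rewrite E2y E1y E2y1 mul0r add0r invr1 mulr1.
have kl : kap t / lam t != 0 by rewrite mulf_neq0 ?invr_eq0 ?kap_neq0.
have hst : hasder (s t) h (h1 (sg t)) by rewrite st.
have MN u : E2 (z (s u)) * (E1 (z (s u)))^-1 = E2 (y u) * (E1 (y u))^-1.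
  have -> : E2 (z (s u)) = lam u * E2 (y u) by rewrite zs /E2 !det3E !mxE; ring.
  have -> : E1 (z (s u)) = lam u * E1 (y u) by rewrite zs /E1 !det3E !mxE; ring.
  by rewrite -mulf_div divff ?mul1r // gt_eqF.
apply: der_eq (der_implicit_comp Md kl Nd hst cs MN) _.
by rewrite div1r invf_div.
Qed.

Lemma vder_comp_sg (f f1 : R -> V) t : (forall u, f (u + 2 * pi) = f u) ->
  (forall u, vder f u (f1 u)) ->
  vder (fun u => f (sg u)) t ((lam t / kap t) *: f1 (sg t)).
Proof.
move=> fp fd i; rewrite mxE.
apply: (@der_comp_sg (fun u => f u 0 i) (fun u => f1 u 0 i)) => u.
  by rewrite fp.
exact: fd.
Qed.

(* Comparing [det (y'', y', y) = 1] along both lifts: the cube of the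
   derivative of [sg] equals the cube of [lam]. *)
Lemma kap1 t : kap t = 1.
Proof.
(* [th] stands for the derivative of [sg]. Differentiability of [lam], [th] and then [l1] is gained
   step by step, each identity giving the next. *)
pose th u := lam u / kap u.
have zd u := vder_comp_sg u (blift_periodic Lz) (blift_d0 Lz).
have z1d u := vder_comp_sg u (blift1_periodic Lz) (blift_d1 Lz).
have [l1 ld] : exists l1 : R -> R, forall u, hasder u lam (l1 u).
  eexists => u; apply: (der_ext (fun v => esym (lamE v))).
  exact: (der_det3 (blift_d2 Ly u) (blift_d1 Ly u) (zd u)).
have kd u := der_det3 (blift_d2 Ly u) (z1d u) (blift_d0 Ly u).
have [th1 thd] : exists th1 : R -> R, forall u, hasder u th (th1 u).
  eexists => u; exact: (derM (ld u) (derV (kap_neq0 u) (kd u))).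
have e1 u : th u *: z1 (sg u) = l1 u *: y u + lam u *: y1 u.
  apply: (vder_unique (zd u)).
  apply: (vder_ext (fun v => esym (zsg v))).
  exact: (vderZ (ld u) (blift_d0 Ly u)).
have l1E u : l1 u = th u * mu u.
  have := congr1 (fun x => det3 (y2 u) (y1 u) x) (e1 u).
  have -> : det3 (y2 u) (y1 u) (th u *: z1 (sg u)) = th u * mu u.
    by rewrite /mu !det3E !mxE; ring.
  have -> : det3 (y2 u) (y1 u) (l1 u *: y u + lam u *: y1 u)
      = l1 u * det3 (y2 u) (y1 u) (y u) by rewrite !det3E !mxE; ring.
  by rewrite (blift_det Ly) mulr1.
have [l2 l1d] : exists l2 : R -> R, forall u, hasder u l1 (l2 u).
  eexists => u; apply: (der_ext (fun v => esym (l1E v))).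
  exact: (derM (thd u) (der_det3 (blift_d2 Ly u) (blift_d1 Ly u) (z1d u))).
have e2 : th1 t *: z1 (sg t) + th t *: (th t *: z2 (sg t))
    = l2 t *: y t + l1 t *: y1 t + (l1 t *: y1 t + lam t *: y2 t).
  apply: (vder_unique (vderZ (thd t) (z1d t))).
  apply: (vder_ext (fun v => esym (e1 v))).
  exact: (vderD (vderZ (l1d t) (blift_d0 Ly t)) (vderZ (ld t) (blift_d1 Ly t))).
have th3 : th t ^+ 3 = lam t ^+ 3.
  rewrite -[LHS]mulr1 -(blift_det Lz (sg t)) -[RHS]mulr1 -(blift_det Ly t).
  have -> : th t ^+ 3 * det3 (z2 (sg t)) (z1 (sg t)) (z (sg t)) =
    det3 (th1 t *: z1 (sg t) + th t *: (th t *: z2 (sg t))) (th t *: z1 (sg t)) (z (sg t)).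
    by rewrite !det3E !mxE; ring.
  by rewrite e1 e2 zsg !det3E !mxE; ring.
(* Real cube roots are unique: the quadratic factor is positive as [lam t > 0]. *)
have : th t = lam t.
  apply/eqP; rewrite -subr_eq0.
  have : (th t - lam t) * (th t ^+ 2 + th t * lam t + lam t ^+ 2)
      = th t ^+ 3 - lam t ^+ 3 by ring.
  rewrite th3 subrr => /eqP; rewrite mulf_eq0 => /orP[//|/eqP q0].
  have := sqr_ge0 (th t + lam t / 2); have := exprn_gt0 2 (lam_gt0 t).
  by move: q0; nra.
rewrite /th => e; apply: (mulfI (lt0r_neq0 (lam_gt0 t))).
by rewrite mulr1 -{1}e divfK ?kap_neq0.
Qed.

Lemma der_comp_sg_lam (h h1 : R -> R) t : (forall u, h (u + 2 * pi) = h u) ->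
  (forall u, hasder u h (h1 u)) ->
  hasder t (fun u => h (sg u)) (lam t * h1 (sg t)).
Proof. by move=> hp hd; have := der_comp_sg t hp hd; rewrite kap1 divr1. Qed.

Lemma vder_comp_sg_lam (f f1 : R -> V) t : (forall u, f (u + 2 * pi) = f u) ->
  (forall u, vder f u (f1 u)) ->
  vder (fun u => f (sg u)) t (lam t *: f1 (sg t)).
Proof. by move=> fp fd; have := vder_comp_sg t fp fd; rewrite kap1 divr1. Qed.

(** The derivative of [mu], which is itself the logarithmic derivative of [lam]. *)
Let nu t := lam t * det3 (y2 t) (y1 t) (z2 (sg t)).

Let z1sg t : z1 (sg t) = y1 t + mu t *: y t.
Proof. by rewrite z1E kap1 scale1r. Qed.

Let lam_der t : hasder t lam (lam t * mu t).
Proof.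
have zd := vder_comp_sg_lam t (blift_periodic Lz) (blift_d0 Lz).
apply: (der_ext (fun v => esym (lamE v))).
apply: der_eq (der_det3 (blift_d2 Ly t) (blift_d1 Ly t) zd) _.
by rewrite zsg /mu !det3E !mxE; ring.
Qed.

Let mu_der t : hasder t mu (nu t).
Proof.
have z1d := vder_comp_sg_lam t (blift1_periodic Lz) (blift_d1 Lz).
apply: der_eq (der_det3 (blift_d2 Ly t) (blift_d1 Ly t) z1d) _.
by rewrite z1sg /nu !det3E !mxE; ring.
Qed.

Let z2sg t : lam t *: z2 (sg t) = y2 t + (nu t *: y t + mu t *: y1 t).
Proof.
apply: (vder_unique (vder_comp_sg_lam t (blift1_periodic Lz) (blift_d1 Lz))).
apply: (vder_ext (fun v => esym (z1sg v))).
exact: (vderD (blift_d1 Ly t) (vderZ (mu_der t) (blift_d0 Ly t))).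
Qed.

(* The transformation rule of [a] under reparametrization, with the Schwarzian
   derivative of [sg] written as [nu - mu ^+ 2 / 2]. *)
Lemma schwarzian_identity t :
  2 * nu t = 2 * a + mu t ^+ 2 - 2 * a' * lam t ^+ 2.
Proof.
have z2d u := vder_comp_sg_lam u (blift2_periodic Lz) (blift_d2 Lz).
(* [mu] is also the coordinate of [lam *: z2 (sg u)] along [y1]; the identity equates the
   derivatives of the two expressions. *)
have muE u : mu u = det3 (y2 u) (lam u *: z2 (sg u)) (y u).
  rewrite z2sg -[LHS]mulr1 -(blift_det Ly u) !det3E !mxE; ring.
have := der_unique (der_ext muE (mu_der t))
  (der_det3 (blift_d2 Ly t) (vderZ (lam_der t) (z2d t)) (blift_d0 Ly t)).
have -> : (lam t * mu t) *: z2 (sg t) = mu t *: (lam t *: z2 (sg t)).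
  by rewrite scalerA mulrC.
rewrite z2sg z1sg zsg.
set w := blift_det Ly t.
have e1 : det3 (- (2 * a) *: y1 t - b t *: y t) (y2 t + (nu t *: y t + mu t *: y1 t)) (y t)
  = 2 * a * det3 (y2 t) (y1 t) (y t) by rewrite !det3E !mxE; ring.
have e3 : det3 (y2 t) (y2 t + (nu t *: y t + mu t *: y1 t)) (y1 t)
  = - nu t * det3 (y2 t) (y1 t) (y t) by rewrite !det3E !mxE; ring.
have e2 : det3 (y2 t) (mu t *: (y2 t + (nu t *: y t + mu t *: y1 t)) +
     lam t *: (lam t *: (- (2 * a') *: (y1 t + mu t *: y t) - b' (sg t) *: (lam t *: y t)))) (y t)
  = (mu t ^+ 2 - 2 * a' * lam t ^+ 2) * det3 (y2 t) (y1 t) (y t).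
  by rewrite !det3E !mxE; ring.
by rewrite e1 e2 e3 w; lra.
Qed.

Let sg_periodic t : exists n : int, sg (t + 2 * pi) = sg t + n%:~R * (2 * pi).
Proof.
apply: blift_same_ray; rewrite !zsg (blift_periodic Ly).
apply: (@same_ray_trans _ _ (y t)); last by exists (lam (t + 2 * pi)).
by apply: same_ray_sym; exists (lam t).
Qed.

Lemma lam_cst t : a < 2^-1 -> lam t = lam 0.
Proof.
move=> a_lt; have l0 u := lt0r_neq0 (lam_gt0 u).
have lamp u : lam (u + 2 * pi) = lam u.
  rewrite !lamE (blift2_periodic Ly) (blift1_periodic Ly).
  by have [n ->] := sg_periodic u; rewrite (periodic_int (blift_periodic Lz)).
have mup u : mu (u + 2 * pi) = mu u.
  rewrite /mu (blift2_periodic Ly) (blift1_periodic Ly).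
  by have [n ->] := sg_periodic u; rewrite (periodic_int (blift1_periodic Lz)).
have mu0 u : - (mu u * (lam u)^-1) = 0.
  (* The functions are [1 / lam] and its first two derivatives, [nu] being eliminated by the
     Schwarzian identity. *)
  apply: (@periodic_oscillator_cst _ a (fun u => (lam u)^-1)
    (fun u => - (mu u * (lam u)^-1))
    (fun u => mu u ^+ 2 * (lam u)^-1 * 2^-1 - a * (lam u)^-1 + a' * lam u)) => // {}u.
  - apply: der_eq (derV (l0 u) (lam_der u)) _.
    by field.
  - have := derV (l0 u) (lam_der u) => ld.
    apply: der_eq (derN (derM (mu_der u) ld)) _.
    have -> : nu u = (2 * a + mu u ^+ 2 - 2 * a' * lam u ^+ 2) / 2.
      by rewrite -schwarzian_identity; field.
    by field.
  - have ld := derV (l0 u) (lam_der u); have ml := mu_der u; have ll := lam_der u.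
    apply: der_eq (derD (derD (derM (derM (derX2 ml) ld) (derC _ _))
      (derN (derM (derC _ _) ld))) (derM (derC _ _) ll)) _.
    have -> : nu u = (2 * a + mu u ^+ 2 - 2 * a' * lam u ^+ 2) / 2.
      by rewrite -schwarzian_identity; field.
    by rewrite /=; field.
  - by rewrite lamp.
  - by rewrite lamp mup.
  - by rewrite lamp mup.
apply: der0_cst => u; have := lam_der u.
have := mu0 u => /eqP; rewrite oppr_eq0 mulf_eq0 invr_eq0 (negbTE (l0 u)) orbF.
by move=> /eqP ->; rewrite mulr0.
Qed.

(** [sg] is known only modulo [2 pi], so it is compared with the affine function through the cosine
    of their difference, whose derivative is 0. *)
Lemma sg_affine t : a < 2^-1 -> z (sg 0 + lam 0 * t) = lam 0 *: y t.
Proof.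
move=> a_lt.
have [n e] : exists n : int, sg t - (sg 0 + lam 0 * t) = n%:~R * (2 * pi).
  apply: cos_eq1; rewrite cosB.
  pose E u := cos (sg u) * cos (sg 0 + lam 0 * u) + sin (sg u) * sin (sg 0 + lam 0 * u).
  have -> : 1 = E 0 by rewrite /E mulr0 addr0 -!expr2 cos2Dsin2.
  apply: (der0_cst (f := E)) => u; rewrite /E.
  have cd : hasder u (fun u => cos (sg u)) (lam u * - sin (sg u)).
    apply: (der_comp_sg_lam (h := @cos R) (h1 := fun v => - sin v)) => v.
      by rewrite mulr_natl cosD2pi.
    exact: is_derive_cos.
  have sd : hasder u (fun u => sin (sg u)) (lam u * cos (sg u)).
    apply: (der_comp_sg_lam (h := @sin R) (h1 := @cos R)) => v.
      by rewrite mulr_natl sinD2pi.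
    exact: is_derive_sin.
  have cl : hasder u (fun u => cos (sg 0 + lam 0 * u)) (- sin (sg 0 + lam 0 * u) * lam 0).
    by der_ring.
  have sl : hasder u (fun u => sin (sg 0 + lam 0 * u)) (cos (sg 0 + lam 0 * u) * lam 0).
    by der_ring.
  apply: der_eq (derD (derM cd cl) (derM sd sl)) _.
  by rewrite (lam_cst u a_lt); ring.
have -> : sg 0 + lam 0 * t = sg t + (- n)%:~R * (2 * pi).
  by rewrite intrN; lra.
by rewrite (periodic_int (blift_periodic Lz)) zsg (lam_cst t a_lt).
Qed.

(** If [lam 0 < 1], then [z] returns to its initial ray before a full period; if [lam 0 > 1], then
    [y] does. *)
Lemma lam_eq1 : a < 2^-1 -> lam 0 = 1.
Proof.
move=> a_lt; have l0 := lam_gt0 0; have pi0 := pi_gt0 R.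
have zy t := sg_affine t a_lt; set l := lam 0 in l0 zy *.
have z0 : z (sg 0) = l *: y 0 by rewrite -zy mulr0 addr0.
have [lt|gt|//] := ltgtP l 1.
- have [] := @lift_not_same_ray _ _ _ _ _ _ _ Lz (sg 0) (sg 0 + l * (2 * pi)).
    have : 0 < l * (2 * pi) < 2 * pi.
      by rewrite mulr_gt0 ?mulr_gt0 //= gtr_pMl ?mulr_gt0.
    by lra.
  by rewrite zy -[2 * pi]add0r (blift_periodic Ly) z0; exact: same_ray_refl.
- have [] := @lift_not_same_ray _ _ _ _ _ _ _ Ly 0 (2 * pi / l).
    by rewrite subr0 divr_gt0 ?mulr_gt0 //= ltr_pdivrMr // ltr_pMr ?mulr_gt0.
  have -> : y (2 * pi / l) = y 0; last exact: same_ray_refl.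
  apply: (scalerI (lt0r_neq0 l0)).
  by rewrite -zy mulrC divfK ?gt_eqF // (blift_periodic Lz).
Qed.

End Reparametrization.

(** * From balanced parametrizations to lifts *)

Section BalancedLift.
Context {R : realType}.
Notation V := 'rV[R]_3.

Lemma balanced_has_lift (K : set V) (p : R -> V) :
  regular_convex_cone K -> balanced K p ->
  exists y y1 y2 a b, balanced_lift K y y1 y2 a b /\
    forall t, same_ray (p t) (y t).
Proof.
move=> Kc [[pbd pper pcov] [y [a [b [yper ybd yd ydet yode]]]]].
exists y, (derive1n 1 y), (derive1n 2 y), a, b.
have py t : same_ray (p t) (y t) by have [] := ybd t.
split => //; split => //.
- by move=> t; have [] := ybd t.
- move=> t; have [_ [l [l0 ->]]] := ybd t; have [_ pn0] := pbd t.
  by rewrite scaler_eq0 gt_eqF.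
- move=> x xbd x0; have [t [tI tx _]] := pcov x xbd x0.
  by exists t => //; apply: same_ray_trans tx; exact: same_ray_sym.
(* Injectivity on a period comes from the uniqueness of the parameter of a ray under [p]. *)
- move=> t t' tI t'I tt'; have [pb p0] := pbd t.
  have [u [_ _ uP]] := pcov _ pb p0.
  rewrite (uP t tI (same_ray_refl _)) (uP t' t'I) //.
  apply: (same_ray_trans (py t')).
  exact: (same_ray_trans (same_ray_sym tt') (same_ray_sym (py t))).
- by move=> t; apply: vderP; exact: yd 0%N isT t.
- by move=> t; apply: vderP; exact: yd 1%N isT t.
- move=> t; have -> : - (2 * a) *: derive1n 1 y t - b t *: y t = derive1n 3 y t.
    have := yode t; rewrite derive1_cst scale0r addr0 => /eqP.
    rewrite -addrA addr_eq0 => /eqP ->.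
    by rewrite opprD scaleNr.
  by apply: vderP; exact: yd 2%N isT t.
Qed.

End BalancedLift.

(** * Uniqueness up to translation *)

Unset Implicit Arguments.

Theorem theorem2 (R : realType) (K : set 'rV[R]_3) (k : nat) :
  regular_convex_cone K -> ~ ellipsoidal K -> (5 <= k)%N ->
  Ck_pos_curved_boundary K k ->
  forall p q : R -> 'rV[R]_3, balanced K p -> balanced K q ->
  exists c : R, forall t : R, same_ray (p t) (q (t + c)).
Proof.
move=> Kc Kne _ _ p q bp bq.
have [y [y1 [y2 [a [b [Ly py]]]]]] := balanced_has_lift Kc bp.
have [z [z1 [z2 [a' [b' [Lz qz]]]]]] := balanced_has_lift Kc bq.
have a_lt : a < 2^-1.
  by rewrite ltNge; apply/negP => /(blift_ellipsoidal Ly).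
(* A parameter of [z] and a positive factor are chosen for each [t], with no regularity in [t]
   required. *)
have /choice[f fP] : forall t, exists sl : R * R,
    0 < sl.2 /\ z sl.1 = sl.2 *: y t.
  move=> t.
  have [s _ /same_ray_sym[l [l0 zE]]] := blift_surj Lz (blift_bd Ly t) (blift_neq0 Ly t).
  by exists (s, l).
pose sg t := (f t).1; pose lam t := (f t).2.
have lam0 t : 0 < lam t by have [] := fP t.
have zsg t : z (sg t) = lam t *: y t by have [] := fP t.
(* Since [lam] is identically 1, the two parameters differ by the value of [sg] at 0. *)
exists (sg 0) => t.
have zy := sg_affine Ly Lz lam0 zsg t a_lt.
rewrite (lam_eq1 Ly Lz lam0 zsg a_lt) mul1r scale1r addrC in zy.
apply: (same_ray_trans (py t)); apply: same_ray_sym.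
by rewrite -zy; exact: qz.
Qed.
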